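(* Let $m\ge 1$ be an integer and let $\mathcal{P}_{4m}$ be the minimal regular cover of the $4m$-prism. Then $\mathcal{P}_{4m}$ has $8m^3$ vertices, $12m^3$ edges and $6m^2$ faces, and it lies on a compact orientable surface of Euler characteristic $(6-4m)m^2$, that is, of genus $(2m-3)m^2+1$.
   Context: An abstract polyhedron $\mathcal{P}$ is a partially ordered set such that: (P1) it has a unique minimum face $F_{-1}$ and a unique maximum face $F_3$; (P2) every maximal totally ordered subset (flag) contains $F_{-1}$ and $F_3$ and has exactly $5$ elements (so there is a rank function; the elements of rank $0,1,2$ are vertices, edges, faces); (P3) it is strongly connected, meaning every section $G/F=\{H: F\le H\le G\}$ is connected, where a poset of rank $n$ is connected if $n\le 1$ or any two of its proper faces are joined by a finite sequence of proper faces with consecutive ones incident (comparable); (P4) every edge is incident to exactly two vertices and exactly two faces, and if a vertex $V$ is incident to a face $F$ there are exactly two edges incident to both. For a flag $\Psi$ and $i\in\{0,1,2\}$, $\Psi^i$ denotes the unique flag differing from $\Psi$ exactly in its element of rank $i$. $\Gamma(\mathcal{P})$ is the automorphism group of $\mathcal{P}$; $\mathcal{P}$ is regular if $\Gamma(\mathcal{P})$ is transitive on flags. For a regular $\mathcal{P}$ with base flag $\Phi$, the distinguished generators are the involutions $\rho_i$ with $\Phi\rho_i=\Phi^i$. The monodromy group $\mathrm{Mon}(\mathcal{Q})=\langle r_0,r_1,r_2\rangle$ of a polyhedron $\mathcal Q$ is the group of permutations of its flags generated by $r_i:\Psi\mapsto\Psi^i$. A regular polyhedron $\mathcal{P}$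 covers $\mathcal{Q}$ if there is a group homomorphism $\Gamma(\mathcal{P})\to\mathrm{Mon}(\mathcal{Q})$ with $\rho_i\mapsto r_i$ for $i=0,1,2$. $\mathcal{P}$ is a minimal regular cover of $\mathcal{Q}$ if $\mathcal{P}$ is regular, covers $\mathcal{Q}$, and any regular polyhedron $\mathcal{R}$ that covers $\mathcal{Q}$ and is covered by $\mathcal{P}$ equals $\mathcal{P}$. (It is known that the minimal regular cover is unique up to isomorphism: it is the regular polyhedron whose automorphism group with distinguished generators is $\mathrm{Mon}(\mathcal{Q})$ with generators $r_0,r_1,r_2$.) The $n$-prism is the face lattice of the convex $n$-gonal prism: vertices $u_i,v_i$ ($i\in\mathbb{Z}/n$), edges $u_iu_{i+1}$, $v_iv_{i+1}$, $u_iv_i$, and faces the two $n$-gons $u_0\cdots u_{n-1}$, $v_0\cdots v_{n-1}$ and the $n$ squares $u_iu_{i+1}v_{i+1}v_i$. The surface on which a finite polyhedron lies is the surface obtained by taking one triangle for each flag, with corners labelled $0,1,2$, and gluing the triangles of $\Psi$ and $\Psi^i$ along the sides opposite the corners labelled $i$ (respecting labels); the polyhedron is thereby a map on this surface, with Euler characteristic the number of vertices minus the number of edges plus the number of faces. *)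

(* Defs.v *)
From HB Require Import structures.
From Stdlib Require Import Relation_Operators.
From mathcomp Require Import all_boot all_order all_algebra perm generic_quotient.
From mathcomp Require Import all_classical all_reals all_analysis.

Set Implicit Arguments.
Unset Strict Implicit.
Unset Printing Implicit Defensive.

Import Order.TTheory GRing.Theory Num.Theory.
Import numFieldNormedType.Exports.

Local Open Scope classical_set_scope.
Local Open Scope card_scope.
Local Open Scope ring_scope.

(* Posets are structures of type [tbPOrderType]: [\bot] and [\top] are the
   improper faces F_{-1} and F_3.  No finiteness is assumed; classically, every
   poset with a least and a greatest element carries such a structure. *)

Section Polyhedra.
Context {d : Order.disp_t} (P : tbPOrderType d).

Definition is_flag : set (set P) :=
  [set A | total_on A (fun x y : P => (x <= y)%O) /\
           forall B : set P, total_on B (fun x y : P => (x <= y)%O) ->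
                             A `<=` B -> B = A].

Definition flag : Type := set_type is_flag.
HB.instance Definition _ := Choice.on flag.

Definition elements (Psi : flag) : set P := set_val Psi.

(* The rank of x is one less than the number of elements below x in a flag
   through x, so that \bot has rank -1. *)
Definition has_rank (x : P) (r : int) : Prop :=
  exists (Psi : flag) (n : nat),
    [/\ elements Psi x, [set y | elements Psi y /\ (y < x)%O] #= `I_n
      & r = n%:Z - 1].

Definition faces_of_rank (r : int) : set P := [set x | has_rank x r].

(* Connectedness of the section G/F, whose rank is rank G - rank F - 1 and
   whose proper faces are the H with F < H < G. *)
Definition section_connected (F G : P) : Prop :=
  (exists r s : int, [/\ has_rank F r, has_rank G s & s - r - 1 <= 1]) \/
  (forall H K : P, (F < H < G)%O -> (F < K < G)%O ->
     exists s : seq P,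
       [/\ path (fun x y : P => (x >=< y)%O) H s,
           all (fun x : P => (F < x < G)%O) s & last H s = K]).

Record polyhedron : Prop := Polyhedron {
  flag_card : forall A : set P, is_flag A -> [/\ A \bot%O, A \top%O & A #= `I_5];
  strongly_connected : forall F G : P, (F <= G)%O -> section_connected F G;
  diamond_edge_vertices : forall E : P, has_rank E 1 ->
    [set V | has_rank V 0 /\ (V >=< E)%O] #= `I_2;
  diamond_edge_faces : forall E : P, has_rank E 1 ->
    [set F | has_rank F 2 /\ (F >=< E)%O] #= `I_2;
  diamond_vertex_face : forall V F : P, has_rank V 0 -> has_rank F 2 ->
    (V >=< F)%O ->
    [set E | [/\ has_rank E 1, (E >=< V)%O & (E >=< F)%O]] #= `I_2
}.

Definition adjacent_flag (i : 'I_3) (Psi Psi' : flag) : Prop :=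
  Psi' <> Psi /\
  forall x : P, ~ has_rank x i%:Z -> (elements Psi' x <-> elements Psi x).

(* Psi^i; in a polyhedron exactly one flag is i-adjacent to Psi, so that the
   default value Psi is never used. *)
Definition adj (i : 'I_3) (Psi : flag) : flag := xget Psi (adjacent_flag i Psi).

Definition automorphism : set (P -> P) :=
  [set a | bijective a /\ {mono a : x y / (x <= y)%O}].

Definition regular_polyhedron : Prop :=
  polyhedron /\
  forall Psi Psi' : flag,
    exists2 a, automorphism a & a @` elements Psi = elements Psi'.

Definition permutation_group (T : Type) (G : set (T -> T)) : Prop :=
  [/\ forall f, G f -> bijective f,
      G id,
      forall f g, G f -> G g -> G (g \o f)
    & forall f g, G f -> cancel f g -> cancel g f -> G g].

Definition Mon : set (flag -> flag) :=
  smallest (@permutation_group flag) (range adj).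

(* [rho] is the triple of distinguished generators for the base flag Phi. *)
Definition distinguished (Phi : flag) (rho : 'I_3 -> P -> P) : Prop :=
  forall i : 'I_3,
    automorphism (rho i) /\ rho i @` elements Phi = elements (adj i Phi).

End Polyhedra.

Arguments faces_of_rank {d} P r.

Section Covers.

(* Products are compositions in both groups.  Being a homomorphism does not
   depend on whether permutations are composed from the left or the right, as
   long as the same convention is used on both sides. *)
Definition covers {d d' : Order.disp_t}
    (P : tbPOrderType d) (Q : tbPOrderType d') : Prop :=
  exists (Phi : flag P) (rho : 'I_3 -> P -> P)
         (phi : (P -> P) -> (flag Q -> flag Q)),
    [/\ distinguished Phi rho,
        forall a, automorphism a -> Mon (phi a),
        forall a b, automorphism a -> automorphism b ->
          phi (b \o a) = phi b \o phi a
      & forall i : 'I_3, phi (rho i) = adj i].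

Definition isomorphic {d d' : Order.disp_t}
    (P : tbPOrderType d) (Q : tbPOrderType d') : Prop :=
  exists2 f : P -> Q, bijective f & {mono f : x y / (x <= y)%O}.

(* Polyhedra are identified when they are isomorphic. *)
Definition minimal_regular_cover {d d' : Order.disp_t}
    (P : tbPOrderType d) (Q : tbPOrderType d') : Prop :=
  [/\ regular_polyhedron P, covers P Q &
      forall (e : Order.disp_t) (R : tbPOrderType e),
        regular_polyhedron R -> covers R Q -> covers P R -> isomorphic R P].

End Covers.

(* The n-prism for n >= 3.  The vertices u_i and v_i are (false, i) and
   (true, i), where [ordS] is the successor modulo n on 'I_n.  Each face is
   represented by the set of its vertices, and incidence is inclusion. *)
Section Prism.
Variable n : nat.

Definition prism_face (A : {set bool * 'I_n}) : bool :=
  [|| A == finset.set0,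
      [exists x, A == [set x]%SET],
      [exists b : bool, exists i : 'I_n, A == [set (b, i); (b, ordS i)]%SET],
      [exists i : 'I_n, A == [set (false, i); (true, i)]%SET],
      [exists b : bool, A == [set x | x.1 == b]%SET],
      [exists i : 'I_n, A == [set x | x.2 \in [:: i; ordS i]]%SET]
    | A == [set: bool * 'I_n]%SET].

Record prism : Type := Prism {
  prism_vertices : {set bool * 'I_n};
  _ : prism_face prism_vertices
}.

HB.instance Definition _ := [isSub for prism_vertices].
HB.instance Definition _ := [Finite of prism by <:].
Definition prism_le : rel prism :=
  fun x y => prism_vertices x \subset prism_vertices y.

Fact prism_le_refl : reflexive prism_le.
Proof. by move=> x; exact: subxx. Qed.

Fact prism_le_anti : antisymmetric prism_le.
Proof. by move=> x y xy; apply/val_inj/eqP; rewrite finset.eqEsubset. Qed.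

Fact prism_le_trans : transitive prism_le.
Proof. by move=> y x z; exact: fintype.subset_trans. Qed.

HB.instance Definition _ :=
  Order.Le_isPOrder.Build Order.SetSubsetOrder.subset_display prism
    prism_le_refl prism_le_anti prism_le_trans.

Fact prism_face0 : prism_face finset.set0.
Proof. by rewrite /prism_face eqxx. Qed.

Fact prism_faceT : prism_face [set: bool * 'I_n]%SET.
Proof. by rewrite /prism_face eqxx !orbT. Qed.

Definition prism_bottom : prism := Prism prism_face0.
Definition prism_top : prism := Prism prism_faceT.

Fact prism_ge_bottom (x : prism) : (prism_bottom <= x)%O.
Proof. exact: finset.sub0set. Qed.

Fact prism_le_top (x : prism) : (x <= prism_top)%O.
Proof. exact: finset.subsetT. Qed.

HB.instance Definition _ :=
  Order.hasBottom.Build Order.SetSubsetOrder.subset_display prism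
    prism_ge_bottom.
HB.instance Definition _ :=
  Order.hasTop.Build Order.SetSubsetOrder.subset_display prism
    prism_le_top.

End Prism.

Section Surface.
Context (R : realType) {d : Order.disp_t} (P : tbPOrderType d).

(* The points of a triangle are given by barycentric coordinates with respect
   to its corners 0, 1, 2; the side opposite the corner i is t_i = 0. *)
Definition triangle : set 'rV[R]_3 :=
  [set t | (forall i : 'I_3, 0 <= t 0 i) /\ \sum_(i < 3) t 0 i = 1].

Definition triangles : Type := {_ : flag P & triangle}.
HB.instance Definition _ := Topological.on triangles.

Definition glue_side (a b : triangles) : Prop :=
  exists i : 'I_3, [/\ projT1 b = adj i (projT1 a), projT2 b = projT2 a
                     & (set_val (projT2 a) : 'rV[R]_3) 0 i = 0].

Definition glued : rel triangles :=
  fun a b => `[< clos_refl_sym_trans triangles glue_side a b >].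

Fact glued_refl : reflexive glued.
Proof. by move=> a; apply/asboolP; exact: rst_refl. Qed.

Fact glued_sym : symmetric glued.
Proof. by move=> a b; apply/asboolP/asboolP; exact: rst_sym. Qed.

Fact glued_trans : transitive glued.
Proof.
by move=> b a c /asboolP ab /asboolP bc; apply/asboolP; exact: rst_trans ab bc.
Qed.

Definition glued_equiv := EquivRel glued glued_refl glued_sym glued_trans.

Local Open Scope quotient_scope.

Definition surface : Type := quotient_topology {eq_quot glued_equiv}.
HB.instance Definition _ := Topological.on surface.

End Surface.

Section SurfaceInvariants.
Context {d : Order.disp_t} (P : tbPOrderType d).

(* An orientation of a triangle is a cyclic permutation of its three corners.
   The surface is orientable if its triangles can be oriented coherently: two
   triangles glued along a side traverse it in opposite directions.  Below, the
   side opposite i is traversed from j to [o Psi j] in the triangle of Psi. *)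
Definition orientable : Prop :=
  exists o : flag P -> {perm 'I_3},
    (forall Psi (j : 'I_3), o Psi j != j) /\
    (forall Psi (i j : 'I_3), j != i -> o Psi j != i ->
       o (adj i Psi) (o Psi j) = j).

Definition has_euler_characteristic (chi : int) : Prop :=
  exists v e f : nat,
    [/\ faces_of_rank P 0 #= `I_v, faces_of_rank P 1 #= `I_e,
        faces_of_rank P 2 #= `I_f & chi = v%:Z - e%:Z + f%:Z].

(* The genus of a compact orientable surface: chi = 2 - 2 g. *)
Definition has_genus (g : nat) : Prop :=
  orientable /\ has_euler_characteristic (2 - 2 * g%:Z).

End SurfaceInvariants.

(* Main.v *)
Require Import Defs.
From HB Require Import structures.
From mathcomp Require Import all_boot all_order all_algebra all_fingroup.
From mathcomp Require Import generic_quotient zify.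
From mathcomp Require Import all_classical all_reals all_analysis.

Set Implicit Arguments.
Unset Strict Implicit.
Unset Printing Implicit Defensive.

Import Order.TTheory GRing.Theory Num.Theory.
Import numFieldNormedType.Exports.

Local Open Scope classical_set_scope.
Local Open Scope card_scope.
Local Open Scope ring_scope.

(** The idea is to describe both polyhedra by cubic graphs whose edges are
    properly coloured with three colours.  The edge graph of a prism over a
    2k-gon has such a colouring: the edges joining the two rims get colour 0,
    and the edges along the rims alternate between the colours 1 and 2.  Write
    h_i for the involution that moves a vertex along its edge of colour i.  Each
    face then contains the edges of exactly two colours, so that it may be given
    the third colour, and a flag is the same thing as a vertex u with an ordering
    p of the colours: its edge has colour p 0 and its face has colour p 2.  In
    this description r_1 and r_2 only permute the ordering, and r_0 replaces u by
    h_(p 0) u (lemma [adj_fl]).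

    Around one rim of the 4m-prism h_1 and h_2 are the two perfect matchings of a
    4m-cycle, which generate a dihedral group of order 4m acting simply
    transitively on that cycle.  A word in the r_i acts trivially on the flags of
    the prism when the colour words that it induces do so for each of the ways of
    naming the colours, that is, when they vanish in three such dihedral groups,
    one for each choice of the colour of the rungs.  Inside the product of the
    three groups the h_i generate a subgroup of order 8m^3: its elements are
    given by the parities of the three colours and by a winding number modulo m
    for each factor.  Its Cayley graph, with the orbits of pairs of colours as
    faces, is a polyhedron R with 8m^3 vertices ([cover_vertex]).

    The polyhedron R is regular: the graph has a half-turn that moves the origin
    along an edge, a mirror and a threefold rotation fixing the origin
    ([origin_symmetric]), and these carry the base flag to its neighbours.
    There are three projections of R to the prism which commute with the r_i.
    Each is surjective and together they are injective, so that the r_i satisfy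
    the same relations on the flags of R and on those of the prism
    ([word_equiv]).  Hence R covers the prism ([cells_cover]), and every
    polyhedron that covers the prism covers R ([covers_trans_words]).  By
    minimality P is isomorphic to R.

    Every edge of R has one vertex of even parity, which gives 3 * 4m^3 edges; the
    faces of a given colour are labelled by a parity and two residues modulo m,
    which gives 3 * 2m^2 faces.  The parity of the vertex plus the sign of the
    ordering is a two-colouring of the flags in which adjacent flags differ; this
    orients the surface, which is compact because there are finitely many flags. *)

(** * Permutations of three colours *)

Notation c0 := (@Ordinal 3 0 isT).
Notation c1 := (@Ordinal 3 1 isT).
Notation c2 := (@Ordinal 3 2 isT).

Lemma ord3P (P : 'I_3 -> Prop) : P c0 -> P c1 -> P c2 -> forall i, P i.
Proof.
move=> P0 P1 P2 [[|[|[|//]]] lti].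
- by rewrite (_ : Ordinal _ = c0) //; apply: val_inj.
- by rewrite (_ : Ordinal _ = c1) //; apply: val_inj.
- by rewrite (_ : Ordinal _ = c2) //; apply: val_inj.
Qed.

Lemma third_colour (i j : 'I_3) : exists2 k, k != i & k != j.
Proof.
by elim/ord3P: i; elim/ord3P: j;
  (by exists c0) || (by exists c1) || (by exists c2).
Qed.

Lemma perm3_values (p : 'S_3) (i : 'I_3) :
  [\/ i = p c0, i = p c1 | i = p c2].
Proof.
by rewrite -(permKV p i); elim/ord3P: (p^-1 i)%g;
  [constructor 1|constructor 2|constructor 3].
Qed.

Lemma third_colour_unique (i j k l : 'I_3) : i != j ->
  k != i -> k != j -> l != i -> l != j -> k = l.
Proof.
by elim/ord3P: i; elim/ord3P: j => //; elim/ord3P: k => //; elim/ord3P: l.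
Qed.

Lemma perm3_ext (p q : 'S_3) (i j : 'I_3) : i != j ->
  p i = q i -> p j = q j -> p = q.
Proof.
move=> ij pi pj; apply/permP => x.
have [->//|xi] := eqVneq x i; have [->//|xj] := eqVneq x j.
apply: (@third_colour_unique (p i) (p j)); rewrite ?pi ?pj ?(inj_eq perm_inj) //.
all: by rewrite -?pi -?pj (inj_eq perm_inj).
Qed.

Lemma perm3_exists (i j : 'I_3) : i != j ->
  exists p : 'S_3, p c0 = i /\ p c2 = j.
Proof.
move=> ij; exists (tperm c0 i * tperm (tperm c0 i c2) j)%g.
rewrite !permM tpermL; split.
  apply: tpermD; last by rewrite eq_sym.
  by rewrite -[X in _ != X](tpermL c0 i) (inj_eq perm_inj).
by rewrite tpermL.
Qed.

(** * Cells of an edge-coloured cubic graph *)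

Section ColouredGraph.
Variables (U : finType) (L : eqType).
Variables (h : 'I_3 -> U -> U) (phi : 'I_3 -> U -> L).

(** The labels [phi i] enumerate the faces of colour i, which are bounded by edges
    of the two other colours; crossing an edge of colour i changes the face of
    colour i.  The second and third conditions force the edges at a vertex to be
    distinct. *)
Record face_colouring : Prop := FaceColouring {
  hK : forall i, involutive (h i);
  phi_h : forall i j u, j != i -> phi i (h j u) = phi i u;
  phi_hN : forall i u, phi i (h i u) != phi i u }.

Definition edge_set i u : {set U} := [set u; h i u]%SET.
Definition face_set i u : {set U} := [set v | phi i v == phi i u]%SET.

(** The faces of ranks -1 to 3 of the flag with vertex [t.1] and colour ordering
    [t.2], each as its set of vertices.  The default value serves for rank 3. *)
Definition cell (t : U * 'S_3) (k : nat) : {set U} :=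
  nth [set: U]%SET
    [:: finset.set0; [set t.1]%SET; edge_set (t.2 c0) t.1; face_set (t.2 c2) t.1] k.

Definition flag_adj (i : 'I_3) (t : U * 'S_3) : U * 'S_3 :=
  match val i with
  | 0 => (h (t.2 c0) t.1, t.2)
  | 1 => (t.1, tperm c0 c1 * t.2)%g
  | _ => (t.1, tperm c1 c2 * t.2)%g
  end.

(** On cells this is the rank plus one.  The formula is chosen to be monotone on
    all sets of vertices, hence strictly monotone along chains of cells. *)
Definition cdim (S : {set U}) : nat :=
  if S == [set: U]%SET then 4 else minn #|S| 3.

Hypothesis fc : face_colouring.

Lemma h_neq i u : h i u != u.
Proof. by apply: contra_neq (phi_hN fc i u) => ->. Qed.

Lemma h_inj i : injective (h i). Proof. exact: inv_inj (hK fc i). Qed.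

Lemma h_colour i j u : h i u = h j u -> i = j.
Proof.
move=> e; apply/eqP; apply: contraTT (phi_hN fc i u) => ij.
by rewrite e (phi_h fc) ?eqxx // eq_sym.
Qed.

Lemma edge_set_h i u : edge_set i (h i u) = edge_set i u.
Proof. by rewrite /edge_set (hK fc) finset.setUC. Qed.

Lemma edge_set_eq i j u v : edge_set i u = edge_set j v ->
  i = j /\ (v = u \/ v = h i u).
Proof.
move=> e; have : v \in edge_set i u by rewrite e !inE eqxx.
have : h j v \in edge_set i u by rewrite e !inE eqxx orbT.
rewrite !inE => /orP[] /eqP hjv /orP[] /eqP vE.
- by move: (h_neq j v); rewrite hjv vE eqxx.
- split; last by right.
  by apply/esym/(@h_colour _ _ v); rewrite hjv vE (hK fc).
- by split; [apply/esym/(@h_colour _ _ u); rewrite -hjv vE|left].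
- by move: (h_neq j v); rewrite hjv vE eqxx.
Qed.

Lemma face_set_refl i u : u \in face_set i u. Proof. by rewrite inE. Qed.

Lemma face_set_h i j u : j != i -> h j u \in face_set i u.
Proof. by move=> ji; rewrite inE (phi_h fc) ?ji. Qed.

Lemma face_set_hN i u : h i u \notin face_set i u.
Proof. by rewrite inE phi_hN. Qed.

Lemma face_set_sub i j u v : face_set i u \subset face_set j v ->
  i = j /\ phi i u = phi i v.
Proof.
move/fintype.subsetP=> sub; have [ij|ij] := eqVneq i j.
  by subst j; split=> //; move: (sub u); rewrite !inE eqxx => /(_ isT)/eqP.
move: (sub _ (face_set_refl i u)) (sub (h j u)).
by rewrite face_set_h 1?eq_sym // !inE => /eqP <- /(_ isT);
  rewrite (negPf (phi_hN fc _ _)).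
Qed.

Lemma face_set_eq i u v : phi i u = phi i v -> face_set i u = face_set i v.
Proof. by move=> e; apply/setP => w; rewrite !inE e. Qed.

(** Inclusion of vertex sets is incidence: both ends of an edge of colour j lie in
    different faces of colour j. *)
Lemma edge_sub_face i j u v :
  (edge_set i u \subset face_set j v) = (i != j) && (phi j u == phi j v).
Proof.
rewrite finset.subUset !finset.sub1set !inE; have [->|ij] /= := eqVneq i j.
  by apply/negP=> /andP[/eqP e]; rewrite -e (negPf (phi_hN fc _ _)).
by rewrite (phi_h fc) // andbb.
Qed.

Lemma cell_top t k : cell t k.+4 = [set: U]%SET.
Proof. exact: nth_nil. Qed.

Lemma cell_mono t k l : (k <= l)%N -> cell t k \subset cell t l.
Proof.
move: t => [u p].
have face_edge: edge_set (p c0) u \subset face_set (p c2) u.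
  by rewrite edge_sub_face eqxx (inj_eq perm_inj).
case: l => [|[|[|[|l]]]]; case: k => [|[|[|[|k]]]] //= _;
  rewrite ?cell_top ?fintype.subxx ?finset.sub0set ?finset.subsetT //.
- by rewrite finset.sub1set !inE eqxx.
- by rewrite finset.sub1set face_set_refl.
Qed.

Lemma cell_dim t k : (k < 5)%N -> cdim (cell t k) = k.
Proof.
move: t => [u p]; rewrite /cdim.
have e2 i : #|edge_set i u| = 2 by rewrite cards2 eq_sym h_neq.
have f3 i : (2 < #|face_set i u|)%N.
  have [j ji _] := third_colour i i; have [l li lj] := third_colour i j.
  have : [set u; h j u; h l u]%SET \subset face_set i u.
    by rewrite !finset.subUset !finset.sub1set face_set_refl !face_set_h.
  move/subset_leq_card; apply: leq_trans.
  rewrite -finset.setUA cardsU1 cards2 !inE.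
  rewrite ![u == _]eq_sym !(negPf (h_neq _ _)) /=.
  by case: eqVneq => // /h_colour jl; rewrite jl eqxx in lj.
have fT i : face_set i u != [set: U]%SET.
  by apply: contraNneq (face_set_hN i u) => ->; rewrite inE.
have nT (S : {set U}) : (#|S| < 3)%N -> S != [set: U]%SET.
  move=> S3; apply: contraTneq S3 => ->; rewrite -leqNgt.
  by apply: leq_trans (f3 c0) _; rewrite cardsT max_card.
case: k => [|[|[|[|[|//]]]]] _; rewrite /cell /= ?eqxx //.
- by rewrite ifN ?nT ?cards0.
- by rewrite ifN ?nT ?cards1.
- by rewrite ifN ?nT ?e2.
- by rewrite ifN // (minn_idPr _).
Qed.

Lemma dim_mono (S T : {set U}) : S \subset T -> (cdim S <= cdim T)%N.
Proof.
rewrite /cdim => ST; case: (eqVneq T) => [_|T'].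
  by case: ifP => // _; rewrite (leq_trans (geq_minr _ _)).
rewrite ifN; last by apply: contraNneq T' => ST'; rewrite -finset.subTset -ST'.
by rewrite leq_min geq_minr andbT (leq_trans (geq_minl _ _)) ?subset_leq_card.
Qed.

Lemma cell_inj t t' k k' : (k < 5)%N -> (k' < 5)%N ->
  cell t k = cell t' k' -> k = k'.
Proof. by move=> k5 k5' e; rewrite -(cell_dim t k5) e cell_dim. Qed.

(** Comparable cells of equal rank coincide; this makes the chains of a flag
    maximal and excludes chains with two cells of one rank. *)
Lemma cell_sub_eq t t' k : (k < 5)%N ->
  cell t k \subset cell t' k -> cell t k = cell t' k.
Proof.
move: t t' => [u p] [u' p']; case: k => [|[|[|[|[|//]]]]] _; rewrite /cell //=.
- by rewrite finset.sub1set inE => /eqP->.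
- by move=> sub; apply/eqP; rewrite eqEcard sub !cards2 !(eq_sym _ (h _ _)) !h_neq.
- by case/face_set_sub => -> /face_set_eq.
Qed.

Lemma cell_ext t t' : (forall k, (k < 5)%N -> cell t k = cell t' k) -> t = t'.
Proof.
move: t t' => [u p] [u' p'] e.
have := e 1 isT; rewrite /cell /= => /set1_inj uu; subst u'.
have [p0 _] := edge_set_eq (e 2 isT).
have := e 3 isT; rewrite /cell /= => e3.
have := fintype.subxx (face_set (p c2) u); rewrite {2}e3 => /face_set_sub[p2 _].
by congr pair; exact: (@perm3_ext _ _ c0 c2 isT p0 p2).
Qed.

Lemma cell_flag_adj t (i : 'I_3) k : k != i.+1 -> cell (flag_adj i t) k = cell t k.
Proof.
move: t => [u p]; elim/ord3P: i; case: k => [|[|[|[|k]]]] //= _;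
  rewrite /cell /flag_adj /= ?permM ?(tpermD, tpermL, tpermR) //.
- exact: edge_set_h.
- by apply/face_set_eq/(phi_h fc); rewrite (inj_eq perm_inj).
Qed.

Lemma flag_adj_neq i t : flag_adj i t != t.
Proof.
move: t => [u p]; rewrite /flag_adj; elim/ord3P: i => /=; rewrite xpair_eqE.
- by rewrite (negPf (h_neq _ _)).
- rewrite eqxx /=; apply/eqP=> /(congr1 (fun q : 'S_3 => q c0)).
  by rewrite permM tpermL => /perm_inj.
- rewrite eqxx /=; apply/eqP=> /(congr1 (fun q : 'S_3 => q c2)).
  by rewrite permM tpermR => /perm_inj.
Qed.

Lemma flag_adjK i : involutive (flag_adj i).
Proof.
move=> [u p]; elim/ord3P: i; rewrite /flag_adj /= ?(hK fc) //.
  by rewrite mulgA tperm2 mul1g.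
by rewrite mulgA tperm2 mul1g.
Qed.

(** The diamond condition: an edge has two ends, and once the vertex and one of the
    edge and the face are kept, the ordering of the colours can change only by
    one transposition. *)
Lemma cell_adj (i : 'I_3) t t' :
  (forall k, (k < 5)%N -> k != i.+1 -> cell t' k = cell t k) ->
  t' = t \/ t' = flag_adj i t.
Proof.
move: t t' => [u p] [u' p'] e.
have e1 : i != c0 -> u' = u.
  by move=> i0; have := e 1 isT; rewrite eqSS eq_sym => /(_ i0) /set1_inj.
have e2 : i != c1 -> p' c0 = p c0 /\ (u = u' \/ u = h (p c0) u').
  move=> i1; have := e 2 isT; rewrite eqSS eq_sym => /(_ i1) /edge_set_eq[] /=.
  by move=> ->.
have e3 : i != c2 -> p' c2 = p c2.
  move=> i2; have := e 3 isT; rewrite eqSS eq_sym => /(_ i2) /= e3.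
  have := fintype.subxx (face_set (p c2) u).
  by rewrite /cell /= in e3; rewrite -{1}e3 => /face_set_sub[].
have p'V j k : p' j = p k \/ p' j != p k by case: eqVneq; [left|right].
elim/ord3P: i e1 e2 e3 {e} => e1 e2 e3; rewrite /flag_adj /=.
- have [] := e2 isT; have p2 := e3 isT => p0 uE.
  have -> : p' = p by exact: (@perm3_ext _ _ c0 c2 isT p0 p2).
  by case: uE => ->; [left|right; rewrite (hK fc)].
- rewrite (e1 isT); have p2 := e3 isT.
  have [p0|p1|p2'] := perm3_values p (p' c0).
  + by left; congr pair; exact: (@perm3_ext _ _ c0 c2 isT p0 p2).
  + by right; congr pair; apply: (@perm3_ext _ _ c0 c2);
      rewrite ?permM ?tpermL ?tpermD.
  + by move: p2'; rewrite -p2 => /perm_inj.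
- rewrite (e1 isT); have [p0 _] := e2 isT.
  have [p0'|p1|p2] := perm3_values p (p' c2).
  + by move: p0'; rewrite -p0 => /perm_inj.
  + by right; congr pair; apply: (@perm3_ext _ _ c0 c2);
      rewrite ?permM ?tpermR ?tpermD.
  + by left; congr pair; exact: (@perm3_ext _ _ c0 c2 isT p0 p2).
Qed.

End ColouredGraph.

(** * Posets of cells and their flags *)

Lemma predzS (n : nat) : n.+1%:Z - 1 = n%:Z.
Proof. by rewrite intS addrAC subrr add0r. Qed.

Section CellPoset.
Variables (U : finType) (L : eqType).
Variables (h : 'I_3 -> U -> U) (phi : 'I_3 -> U -> L).
Hypothesis fc : face_colouring h phi.

Local Notation cell := (cell h phi).
Local Notation edge_set := (edge_set h).
Local Notation face_set := (face_set phi).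
Local Notation r := (flag_adj h).

Lemma cell_base u t k : u \in cell t k -> cell t k = cell (u, t.2) k.
Proof.
move: t => [v p]; case: k => [|[|[|[|k]]]].
- by rewrite /cell /= inE.
- by rewrite /cell /= inE => /eqP->.
- by rewrite /cell /= !inE => /orP[]/eqP-> //; rewrite (edge_set_h fc).
- by rewrite /cell /= inE => /eqP e; exact: face_set_eq.
- by rewrite !cell_top.
Qed.

(** A poset is identified with the cells of a coloured graph through an order
    embedding [s].  Stated in this way it applies to the prism, to the explicit
    cover, and to every polyhedron isomorphic to the latter. *)
Record cell_poset d (X : tbPOrderType d) (s : X -> {set U}) : Prop := CellPoset {
  cell_le : forall x y, (x <= y)%O = (s x \subset s y);
  cell_of : forall x, exists t k, (k < 5)%N /\ s x = cell t k;
  of_cell : forall t k, exists x, s x = cell t k }.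

Variables (d : Order.disp_t) (X : tbPOrderType d) (s : X -> {set U}).
Hypothesis Xs : cell_poset s.

Lemma cell_embed_inj : injective s.
Proof. by move=> x y e; apply: le_anti; rewrite !(cell_le Xs) e fintype.subxx. Qed.

(** The element with vertex set [cell t k]; it exists by [of_cell], so that the
    default value is never used. *)
Definition elt t k : X := xget \bot%O [set x | s x = cell t k].

Lemma eltE t k : s (elt t k) = cell t k.
Proof. by rewrite /elt; case: xgetP => // nx; case: (of_cell Xs t k) => x /nx. Qed.

Lemma elt_eq x t k : s x = cell t k -> x = elt t k.
Proof. by move=> sx; apply: cell_embed_inj; rewrite eltE. Qed.

Lemma eltP x : exists t k, (k < 5)%N /\ x = elt t k.
Proof.
by case: (cell_of Xs x) => t [k [k5 /elt_eq]]; exists t, k.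
Qed.

Lemma elt_le t k l : (k <= l)%N -> (elt t k <= elt t l)%O.
Proof. by move=> kl; rewrite (cell_le Xs) !eltE cell_mono. Qed.

Lemma dim_elt t k : (k < 5)%N -> cdim (s (elt t k)) = k.
Proof. by move=> k5; rewrite eltE cell_dim. Qed.

Lemma elt_lt t k l : (l < 5)%N -> (elt t k < elt t l)%O = (k < l)%N.
Proof.
move=> l5; have [kl|lk] := ltnP k l; last by rewrite le_gtF ?elt_le.
have k5 : (k < 5)%N by exact: ltn_trans kl l5.
rewrite lt_def elt_le 1?ltnW // andbT; apply: contraTneq kl => e.
by rewrite -(dim_elt t k5) -e dim_elt // ltnn.
Qed.

Lemma dim_eq_le x y : cdim (s x) = cdim (s y) -> (x <= y)%O -> x = y.
Proof.
case: (eltP x) => t [k [k5 ->]]; case: (eltP y) => t' [k' [k5' ->]].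
rewrite !dim_elt // => kk; subst k'; rewrite (cell_le Xs) !eltE => sub.
by apply/elt_eq; rewrite eltE; apply: cell_sub_eq sub.
Qed.

Lemma dim_lt x y : (x < y)%O -> (cdim (s x) < cdim (s y))%N.
Proof.
move=> xy; rewrite ltn_neqAle dim_mono -?(cell_le Xs) ?ltW // andbT.
by apply/eqP => e; have := xy; rewrite (dim_eq_le e (ltW xy)) ltxx.
Qed.

Definition chain t : set X := [set x | exists2 k, (k < 5)%N & s x = cell t k].

Lemma chain_elt t k : (k < 5)%N -> chain t (elt t k).
Proof. by move=> k5; exists k; rewrite ?eltE. Qed.

Lemma chain_total t : total_on (chain t) (fun x y : X => (x <= y)%O).
Proof.
move=> x y [k _ /elt_eq->] [l _ /elt_eq->].
by case/orP: (leq_total k l) => kl; [left|right]; exact: elt_le.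
Qed.

Lemma chain_is_flag t : is_flag (chain t).
Proof.
split=> [|B Btot sub]; first exact: chain_total.
apply/seteqP; split=> // x Bx; case: (cell_of Xs x) => t' [k [k5 sx]].
exists k => //; have dxE : cdim (s x) = cdim (s (elt t k)).
  by rewrite dim_elt // sx cell_dim.
rewrite -eltE; congr s.
have [le|le] := Btot _ _ Bx (sub _ (chain_elt t k5)); first exact: dim_eq_le.
exact/esym/dim_eq_le.
Qed.

(** In a chain the nonempty vertex sets are nested, so a vertex u of the smallest
    one lies in all of them.  At most one edge and one face occur, and if both do
    they have different colours; hence some ordering of the colours fits. *)
Lemma total_sub_chain (A : set X) :
  total_on A (fun x y : X => (x <= y)%O) -> exists t, A `<=` chain t.
Proof.
move=> Atot.
have tot x y : A x -> A y -> (s x \subset s y) \/ (s y \subset s x).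
  by move=> Ax Ay; rewrite -!(cell_le Xs); exact: Atot.
have [u uP] : exists u, forall x, A x -> s x != finset.set0 -> u \in s x.
  have [[x1 [Ax1 sx1]]|none] :=
      pselect (exists x, A x /\ s x != finset.set0); last first.
    case: (cell_of Xs \bot%O) => -[u _] _; exists u => x Ax sx.
    by case: none; exists x.
  have exn : exists n, `[< exists x, [/\ A x, s x != finset.set0 & #|s x| = n] >].
    by exists #|s x1|; apply/asboolP; exists x1.
  case: (ex_minnP exn) => n /asboolP[x0 [Ax0 sx0 cx0]] nmin.
  have [u us] := set0Pn _ sx0; exists u => x Ax sx.
  have [/fintype.subsetP-> //|sub] := tot _ _ Ax0 Ax.
  suff -> : s x = s x0 by [].
  apply/eqP; rewrite eqEcard sub cx0; apply: nmin; apply/asboolP.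
  by exists x.
(* the colours of the edges and of the faces at u that occur in the chain *)
pose E i := exists2 x, A x & s x = edge_set i u.
pose F i := exists2 x, A x & s x = face_set i u.
have EE i j : E i -> E j -> i = j.
  case=> x Ax xi [y Ay yj].
  have [sub|sub] := tot _ _ Ax Ay; rewrite xi yj in sub.
    have e : edge_set i u = edge_set j u.
      by apply/eqP; rewrite eqEcard sub !cards2 !(eq_sym u) !(h_neq fc).
    by case: (edge_set_eq fc e).
  have e : edge_set j u = edge_set i u.
    by apply/eqP; rewrite eqEcard sub !cards2 !(eq_sym u) !(h_neq fc).
  by case: (edge_set_eq fc e).
have FF i j : F i -> F j -> i = j.
  case=> x Ax xi [y Ay yj].
  by have [] := tot _ _ Ax Ay; rewrite xi yj => /(face_set_sub fc)[].
have EF i j : E i -> F j -> i != j.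
  case=> x Ax xi [y Ay yj].
  have [] := tot _ _ Ax Ay; rewrite xi yj.
    by rewrite edge_sub_face // => /andP[].
  case: (third_colour i i) => k ki _.
  have [p [p0 p2]] : exists p : 'S_3, p c0 = i /\ p c2 = k.
    by apply: perm3_exists; rewrite eq_sym.
  have [q [_ q2]] : exists q : 'S_3, q c0 = (if j == c0 then c1 else c0) /\ q c2 = j.
    by apply: perm3_exists; case: ifP => [/eqP->|/negbT] //; rewrite eq_sym.
  move/dim_mono; have := cell_dim fc (u, p) (isT : 2 < 5)%N.
  have := cell_dim fc (u, q) (isT : 3 < 5)%N.
  by rewrite /cell /= p0 q2 => -> ->.
have [p [pE pF]] : exists p : 'S_3,
    (forall i, E i -> p c0 = i) /\ (forall i, F i -> p c2 = i).
  have [[i Ei]|nE] := pselect (exists i, E i);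
  have [[j Fj]|nF] := pselect (exists j, F j).
  - have [p [p0 p2]] := perm3_exists (EF _ _ Ei Fj); exists p.
    by split=> k; [rewrite p0; exact: EE|rewrite p2; exact: FF].
  - case: (third_colour i i) => j ji _; rewrite eq_sym in ji.
    have [p [p0 p2]] := perm3_exists ji; exists p.
    by split=> k; [rewrite p0; exact: EE|move=> Fk; case: nF; exists k].
  - case: (third_colour j j) => i ij _.
    have [p [p0 p2]] := perm3_exists ij; exists p.
    by split=> k; [move=> Ek; case: nE; exists k|rewrite p2; exact: FF].
  - by exists 1%g; split=> k Hk; [case: nE; exists k|case: nF; exists k].
exists (u, p) => x Ax; case: (cell_of Xs x) => -[v q] [k [k5 sx]].
exists k => //; have [s0|sn0] := eqVneq (s x) finset.set0.
  have := cell_dim fc (v, q) k5; rewrite -sx s0.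
  by have := cell_dim fc (v, q) (isT : 0 < 5)%N => /= -> <-.
have := uP x Ax sn0; rewrite sx => /cell_base {}sxE; rewrite sxE.
rewrite sxE in sx; case: k {k5 sxE} sx => [|[|[|[|k]]]] sx //.
- by rewrite /cell /= (pE (q c0)) //; exists x.
- by rewrite /cell /= (pF (q c2)) //; exists x.
Qed.

Lemma is_flagP (A : set X) : is_flag A -> exists t, A = chain t.
Proof.
case=> Atot Amax; have [t sub] := total_sub_chain Atot; exists t.
by apply/esym/Amax => //; exact: chain_total.
Qed.

Definition fl t : flag X := SigSub (mem_set (chain_is_flag t)).

Lemma elements_fl t : elements (fl t) = chain t. Proof. by []. Qed.

Lemma fl_surj Psi : exists t, Psi = fl t.
Proof.
by case: (is_flagP (set_valP Psi)) => t tE; exists t; apply: val_inj.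
Qed.

Lemma chain_below t k : (k < 5)%N ->
  [set y | chain t y /\ (y < elt t k)%O] #= `I_k.
Proof.
move=> k5; have -> : [set y | chain t y /\ (y < elt t k)%O] = elt t @` `I_k.
  apply/seteqP; split=> y.
    by case=> -[l l5 /elt_eq->]; rewrite elt_lt // => lk; exists l.
  case=> l lk <-; split; last by rewrite elt_lt.
  exact/chain_elt/(ltn_trans lk).
apply: inj_card_eq => i j; rewrite !inE /= => ik jk e.
have lt5 l : (l < k)%N -> (l < 5)%N by move=> lk; exact: ltn_trans lk k5.
by rewrite -(dim_elt t (lt5 _ ik)) e dim_elt ?lt5.
Qed.

Lemma has_rankE x (i : int) : has_rank x i <-> i = (cdim (s x))%:Z - 1.
Proof.
split=> [[Psi [n [Px cn ->]]]|->].
  have [t tE] := fl_surj Psi; rewrite {}tE elements_fl in Px cn.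
  case: Px cn => k k5 /elt_eq->; rewrite dim_elt // => cn.
  congr (_%:Z - 1); apply/card_eq_II.
  by apply: card_eq_trans (chain_below t k5); rewrite card_eq_sym.
case: (eltP x) => t [k [k5 ->]]; rewrite dim_elt //.
exists (fl t), k; split=> //.
  exact: chain_elt.
exact: chain_below.
Qed.

Lemma chain_cell t t' k : (k < 5)%N -> chain t (elt t' k) ->
  cell t' k = cell t k.
Proof.
by move=> k5 [l l5]; rewrite eltE => e; rewrite {1}e (cell_inj fc k5 l5 e).
Qed.

Lemma fl_inj : injective fl.
Proof.
move=> t t' e; apply: (cell_ext fc) => k k5; apply: chain_cell => //.
by rewrite -elements_fl -e; exact: chain_elt.
Qed.

Lemma adjacent_fl i t t' :
  adjacent_flag i (fl t) (fl t') <-> t' = r i t.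
Proof.
split=> [[ne same]|->].
  have [k k5 ki|tt|//] := @cell_adj _ _ _ _ fc i t t'.
    apply: chain_cell => //; apply: (proj1 (same (elt t' k) _)).
      rewrite has_rankE dim_elt // => /eqP; rewrite eq_sym subr_eq.
      by rewrite -PoszD addn1 eqz_nat (negPf ki).
    exact: chain_elt.
  by case: ne; rewrite tt.
split=> [/fl_inj /eqP|x nx]; first by rewrite (negPf (flag_adj_neq fc _ _)).
split=> -[k k5]; have [ki|ki] := eqVneq k i.+1.
- move=> sx; case: nx; rewrite has_rankE sx cell_dim // ki.
  by rewrite predzS.
- by rewrite cell_flag_adj // => sx; exists k.
- move=> sx; case: nx; rewrite has_rankE sx cell_dim // ki.
  by rewrite predzS.
- by move=> sx; exists k; rewrite ?cell_flag_adj.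
Qed.

(** The flags of a poset of cells, with their monodromy, are the pairs of a vertex
    and a colour ordering with [flag_adj]. *)
Lemma adj_fl i t : adj i (fl t) = fl (r i t).
Proof.
rewrite /adj; case: xgetP => [Psi _|none].
  by have [t' ->] := fl_surj Psi => /adjacent_fl->.
by case: (none (fl (r i t))); exact/adjacent_fl.
Qed.

Lemma foldr_adj w t : foldr (@adj _ X) (fl t) w = fl (foldr r t w).
Proof. by elim: w => //= i w ->; rewrite adj_fl. Qed.

End CellPoset.

(** * Posets of cells as polyhedra *)

Lemma card_pair (T : Type) (a b : T) : a <> b -> [set a; b] #= `I_2.
Proof.
move=> ab; have -> : [set a; b] = (fun n => if n is 0 then a else b) @` `I_2.
  apply/seteqP; split=> x; first by case=> ->; [exists 0|exists 1].
  by case=> -[|[|n]] //= _ <-; [left|right].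
apply: inj_card_eq => -[|[|i]] [|[|j]]; rewrite !inE //= => _ _ e;
  by case: ab.
Qed.

Section Polyhedron.
Variables (U : finType) (L : eqType).
Variables (h : 'I_3 -> U -> U) (phi : 'I_3 -> U -> L).
Hypothesis fc : face_colouring h phi.
Variables (d : Order.disp_t) (X : tbPOrderType d) (s : X -> {set U}).
Hypothesis Xs : cell_poset h phi s.

Local Notation edge_set := (edge_set h).
Local Notation face_set := (face_set phi).
Local Notation elt := (elt h phi s).

Definition vert u : X := elt (u, 1%g) 1.
Definition edge i u : X := elt (u, tperm c0 i) 2.
Definition face i u : X := elt (u, tperm c2 i) 3.

Lemma s_vert u : s (vert u) = [set u]%SET.
Proof. exact: (eltE Xs). Qed.

Lemma s_edge i u : s (edge i u) = edge_set i u.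
Proof. by rewrite [LHS](eltE Xs) /cell /= tpermL. Qed.

Lemma s_face i u : s (face i u) = face_set i u.
Proof. by rewrite [LHS](eltE Xs) /cell /= tpermL. Qed.

Lemma elt_vert t : elt t 1 = vert t.1.
Proof. by apply: (cell_embed_inj Xs); rewrite [LHS](eltE Xs) [RHS]s_vert. Qed.

Lemma elt_edge t : elt t 2 = edge (t.2 c0) t.1.
Proof. by apply: (cell_embed_inj Xs); rewrite [LHS](eltE Xs) [RHS]s_edge. Qed.

Lemma elt_face t : elt t 3 = face (t.2 c2) t.1.
Proof. by apply: (cell_embed_inj Xs); rewrite [LHS](eltE Xs) [RHS]s_face. Qed.

Lemma dim_vert u : cdim (s (vert u)) = 1. Proof. exact: (dim_elt fc Xs). Qed.
Lemma dim_edge i u : cdim (s (edge i u)) = 2. Proof. exact: (dim_elt fc Xs). Qed.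
Lemma dim_face i u : cdim (s (face i u)) = 3. Proof. exact: (dim_elt fc Xs). Qed.

Lemma dim0 x : cdim (s x) = 0 -> s x = finset.set0.
Proof.
by case: (eltP Xs x) => t [k [k5 ->]]; rewrite (dim_elt fc Xs) // => ->;
  rewrite (eltE Xs).
Qed.

Lemma dim1 x : cdim (s x) = 1 -> exists u, x = vert u.
Proof.
case: (eltP Xs x) => t [k [k5 ->]]; rewrite (dim_elt fc Xs) // => ->.
by exists t.1; rewrite elt_vert.
Qed.

Lemma dim2 x : cdim (s x) = 2 -> exists i u, x = edge i u.
Proof.
case: (eltP Xs x) => t [k [k5 ->]]; rewrite (dim_elt fc Xs) // => ->.
by exists (t.2 c0), t.1; rewrite elt_edge.
Qed.

Lemma dim3 x : cdim (s x) = 3 -> exists i u, x = face i u.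
Proof.
case: (eltP Xs x) => t [k [k5 ->]]; rewrite (dim_elt fc Xs) // => ->.
by exists (t.2 c2), t.1; rewrite elt_face.
Qed.

Lemma dim4 x : cdim (s x) = 4 -> s x = [set: U]%SET.
Proof.
by case: (eltP Xs x) => t [k [k5 ->]]; rewrite (dim_elt fc Xs) // => ->;
  rewrite (eltE Xs).
Qed.

Lemma dim_le4 x : (cdim (s x) <= 4)%N.
Proof. by case: (eltP Xs x) => t [k [k5 ->]]; rewrite (dim_elt fc Xs). Qed.

Lemma s_lt x y : s x \subset s y -> (cdim (s x) < cdim (s y))%N -> (x < y)%O.
Proof.
move=> sub lt; rewrite lt_neqAle (cell_le Xs) sub andbT.
by apply: contraTneq lt => ->; rewrite ltnn.
Qed.

Lemma rank_dim x n : has_rank x (n%:Z) <-> cdim (s x) = n.+1.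
Proof.
rewrite (has_rankE fc Xs); split=> [/eqP|->]; last by rewrite predzS.
by rewrite eq_sym subr_eq -PoszD addn1 eqz_nat => /eqP.
Qed.

Lemma edge_h i u : edge i (h i u) = edge i u.
Proof.
by apply: (cell_embed_inj Xs); rewrite [LHS]s_edge [RHS]s_edge (edge_set_h fc).
Qed.

Lemma edge_eq i j u v : edge i u = edge j v -> i = j /\ (v = u \/ v = h i u).
Proof. by move/(congr1 s); rewrite [LHS]s_edge [RHS]s_edge => /(edge_set_eq fc). Qed.

Lemma vert_inj : injective vert.
Proof. by move=> u v /(congr1 s); rewrite [LHS]s_vert [RHS]s_vert => /set1_inj. Qed.

Lemma face_eqP i j u v : face i u = face j v <-> i = j /\ phi i u = phi i v.
Proof.
split=> [/(congr1 s)|[<- e]].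
  rewrite [LHS]s_face [RHS]s_face => e; apply: (face_set_sub fc).
  by rewrite -e fintype.subxx.
by apply: (cell_embed_inj Xs); rewrite [LHS]s_face [RHS]s_face; exact: face_set_eq.
Qed.

Lemma comparable_vert u y : (0 < cdim (s y))%N -> (vert u >=< y)%O = (u \in s y).
Proof.
move=> y0; rewrite /Order.comparable !(cell_le Xs) s_vert finset.sub1set.
apply/orP/idP => [[//|sub]|]; last by left.
suff -> : y = vert u by rewrite s_vert inE.
apply: (dim_eq_le fc Xs); last by rewrite (cell_le Xs) s_vert.
apply/eqP; rewrite eqn_leq dim_vert y0 andbT -(dim_vert u) dim_mono //.
by rewrite s_vert.
Qed.

Lemma comparable_edge_face i j u v :
  (edge i u >=< face j v)%O = (i != j) && (phi j u == phi j v).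
Proof.
rewrite /Order.comparable !(cell_le Xs) s_edge s_face edge_sub_face //.
apply/orP/idP => [[//|sub]|]; last by left.
by have := dim_mono sub; rewrite -s_edge -s_face dim_edge dim_face.
Qed.

Definition reach (D : pred 'I_3) : rel U :=
  connect [rel u v | [exists i, D i && (v == h i u)]].

Lemma reach_step (D : pred 'I_3) i u : D i -> reach D u (h i u).
Proof. by move=> Di; apply: connect1; apply/existsP; exists i; rewrite Di eqxx. Qed.

Lemma reach_ind (D : pred 'I_3) (P : U -> Prop) u v :
  (forall i w, D i -> P w -> P (h i w)) -> P u -> reach D u v -> P v.
Proof.
move=> Ph Pu /connectP[p]; elim: p u Pu => [|w p IH] u Pu /=; first by move=> _ ->.
by case/andP=> /existsP[i /andP[Di /eqP wE]]; apply: IH; rewrite wE; exact: Ph.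
Qed.

Hypothesis face_conn : forall i u v, phi i u = phi i v -> reach (predC1 i) u v.
Hypothesis conn : forall u v, reach predT u v.

Section Linked.
Variables F G : X.

Definition linked (H K : X) : Prop :=
  exists p : seq X,
    [/\ path (fun x y : X => (x >=< y)%O) H p,
        all (fun x : X => (F < x < G)%O) p & last H p = K].

Lemma linked_refl H : linked H H. Proof. by exists [::]. Qed.

Lemma linked_step H K : (F < K < G)%O -> (H >=< K)%O -> linked H K.
Proof. by move=> Kp HK; exists [:: K]; split; rewrite //= ?HK ?Kp. Qed.

Lemma linked_trans K H M : linked H K -> linked K M -> linked H M.
Proof.
move=> [p [pp ap <-]] [q [pq aq <-]]; exists (p ++ q).
by rewrite cat_path all_cat last_cat pp ap pq aq.
Qed.
End Linked.

(** Handles the sections from the minimum to a face or to the maximum: any two of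
    their vertices are joined along edges with colours in D, all of which lie in
    the section. *)
Lemma bottom_section (D : pred 'I_3) F G :
  cdim (s F) = 0 -> (3 <= cdim (s G))%N ->
  (forall j u, D j -> u \in s G -> edge_set j u \subset s G) ->
  (forall u v, u \in s G -> v \in s G -> reach D u v) ->
  section_connected F G.
Proof.
move=> F0 G3 DG DR; right=> H K /andP[FH HG] /andP[FK KG].
have Fs x : (F < x)%O = (0 < cdim (s x))%N.
  apply/idP/idP=> [/(dim_lt fc Xs)|x0]; first by rewrite F0.
  by apply: s_lt; rewrite ?F0 // (dim0 F0) finset.sub0set.
have vsec u : u \in s G -> (F < vert u < G)%O.
  move=> uG; rewrite Fs dim_vert /=; apply: s_lt.
    by rewrite s_vert finset.sub1set.
  by rewrite dim_vert; apply: leq_trans G3.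
have esec j u : D j -> u \in s G -> (F < edge j u < G)%O.
  move=> Dj uG; rewrite Fs dim_edge /=; apply: s_lt.
    by rewrite s_edge DG.
  by rewrite dim_edge.
have pick x : (F < x)%O -> (x < G)%O ->
    exists u, [/\ u \in s G, linked F G x (vert u) & linked F G (vert u) x].
  move=> Fx xG; have : s x != finset.set0.
    move: Fx; rewrite Fs; apply: contraTneq => ->.
    by case: (cell_of Xs x) => t _; rewrite (cell_dim fc t (isT : 0 < 5)%N).
  case/set0Pn=> u ux; have uG : u \in s G.
    by apply: (fintype.subsetP _ _ ux); rewrite -(cell_le Xs) ltW.
  have ux' : (vert u >=< x)%O by rewrite comparable_vert -?Fs.
  exists u; split=> //; apply: linked_step; rewrite ?vsec ?Fx //.
  by rewrite comparable_sym.
have [u [uG Hu _]] := pick H FH HG; have [v [vG _ vK]] := pick K FK KG.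
apply: (linked_trans Hu); apply: linked_trans vK.
suff [] : v \in s G /\ linked F G (vert u) (vert v) by [].
apply: (reach_ind (P := fun w => w \in s G /\ linked F G (vert u) (vert w)))
  (DR _ _ uG vG) => [j w Dj [wG lw]|].
  have hG : h j w \in s G.
    by apply: (fintype.subsetP (DG _ _ Dj wG)); rewrite !inE eqxx orbT.
  split=> //; apply: (linked_trans lw).
  apply: (@linked_trans _ _ (edge j w)); apply: linked_step; rewrite ?esec ?vsec //.
    by rewrite comparable_vert ?dim_edge // s_edge !inE eqxx.
  by rewrite comparable_sym comparable_vert ?dim_edge // s_edge !inE eqxx orbT.
by split=> //; exact: linked_refl.
Qed.

(** At a vertex, two edges of colours i and j both lie in the face of the third
    colour. *)
Lemma vertex_section F G :
  cdim (s F) = 1 -> cdim (s G) = 4 -> section_connected F G.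
Proof.
move=> /dim1[u ->] G4; right=> H K.
have esec i : (vert u < edge i u < G)%O.
  rewrite !s_lt ?dim_vert ?dim_edge ?G4 ?s_vert ?s_edge ?(dim4 G4) ?finset.subsetT //.
  by rewrite finset.sub1set !inE eqxx.
have fsec i : (vert u < face i u < G)%O.
  rewrite !s_lt ?dim_vert ?dim_face ?G4 ?s_vert ?s_face ?(dim4 G4) ?finset.subsetT //.
  by rewrite finset.sub1set face_set_refl.
have ef i j : i != j -> linked (vert u) G (edge i u) (face j u) /\
    linked (vert u) G (face j u) (edge i u).
  move=> ij; have c : (edge i u >=< face j u)%O.
    by rewrite comparable_edge_face ij eqxx.
  by split; apply: linked_step; rewrite ?esec ?fsec // comparable_sym.
have ee i j : linked (vert u) G (edge i u) (edge j u).
  have [k ki kj] := third_colour i j.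
  apply: (@linked_trans _ _ (face k u)); first by apply: (ef _ _ _).1; rewrite eq_sym.
  by apply: (ef _ _ _).2; rewrite eq_sym.
have sec x : (vert u < x < G)%O -> exists i,
    linked (vert u) G x (edge i u) /\ linked (vert u) G (edge i u) x.
  case/andP=> ux xG; have := dim_lt fc Xs ux; have := dim_lt fc Xs xG.
  have : u \in s x by rewrite -finset.sub1set -s_vert -(cell_le Xs) ltW.
  rewrite G4 dim_vert; case E: (cdim (s x)) => [|[|[|[|k]]]] // ux' _ _.
    have [i [v xE]] := dim2 E; exists i.
    suff -> : x = edge i u by split; exact: ee.
    move: ux'; rewrite xE s_edge !inE => /orP[]/eqP-> //.
    by rewrite edge_h.
  have [i [v xE]] := dim3 E; case: (third_colour i i) => j ji _; exists j.
  suff -> : x = face i u by case: (ef _ _ ji).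
  rewrite xE; apply/face_eqP; split=> //.
  by move: ux'; rewrite xE s_face inE => /eqP.
move=> /sec[i [Hi _]] /sec[j [_ jK]].
exact: (linked_trans Hi (linked_trans (ee i j) jK)).
Qed.

Lemma cells_connected (F G : X) : (F <= G)%O -> section_connected F G.
Proof.
move=> FG; have dFG := dim_mono (etrans (esym (cell_le Xs _ _)) FG).
have dG := dim_le4 G.
have [small|big] := leqP (cdim (s G)) (cdim (s F)).+2.
  left; exists ((cdim (s F))%:Z - 1), ((cdim (s G))%:Z - 1).
  split; rewrite ?(has_rankE fc Xs) //.
  by move: (cdim (s F)) (cdim (s G)) small => k l; lia.
case F0: (cdim (s F)) big => [|[|[|n]]] big.
- have [G3|G3] := ltnP 3 (cdim (s G)).
    have G4 : cdim (s G) = 4 by apply/eqP; rewrite eqn_leq dG.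
    apply: (bottom_section (D := predT)) => //.
    by move=> j u _ _; rewrite (dim4 G4) finset.subsetT.
  have /dim3[i [u GE]] : cdim (s G) = 3 by apply/eqP; rewrite eqn_leq G3.
  apply: (bottom_section (D := predC1 i)) => //.
    move=> j v ji; rewrite GE s_face inE => /eqP uv.
    by rewrite edge_sub_face // (ji : j != i) uv eqxx.
  move=> v w; rewrite GE s_face !inE => /eqP vu /eqP wu.
  by apply: face_conn; rewrite vu.
- by apply: vertex_section => //; apply/eqP; rewrite eqn_leq dG.
- by move: (leq_trans big dG).
- by move: (leq_trans big dG).
Qed.

Lemma cells_polyhedron : polyhedron X.
Proof.
split.
- move=> A /(is_flagP fc Xs)[t ->]; split.
  + exists 0 => //; apply/eqP; rewrite -finset.subset0.
    rewrite -[finset.set0](_ : cell h phi t 0 = _) // -(eltE Xs) -(cell_le Xs).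
    exact: le0x.
  + exists 4 => //; apply/eqP; rewrite finset.eqEsubset finset.subsetT /=.
    by rewrite -(eltE Xs t 4) -(cell_le Xs) lex1.
  + have -> : chain h phi s t = elt t @` `I_5.
      apply/seteqP; split=> x; first by case=> k k5 /(elt_eq Xs)->; exists k.
      by case=> k k5 <-; exact: chain_elt.
    apply: inj_card_eq => i j; rewrite !inE /= => i5 j5 e.
    by rewrite -(dim_elt fc Xs t i5) e dim_elt.
- exact: cells_connected.
- move=> E /rank_dim/dim2[i [u ->]].
  rewrite (_ : [set V | _] = [set vert u; vert (h i u)]).
    by apply: card_pair => /vert_inj/eqP; rewrite eq_sym (negPf (h_neq fc _ _)).
  apply/seteqP; split=> V /=.
    case=> /rank_dim/dim1[v ->]; rewrite comparable_vert ?dim_edge // s_edge !inE.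
    by case/orP=> /eqP->; [left|right].
  by case=> ->; (split; [exact/rank_dim/dim_vert|]);
    rewrite comparable_vert ?dim_edge // s_edge !inE eqxx ?orbT.
- move=> E /rank_dim/dim2[i [u ->]].
  case: (third_colour i i) => j ji _; case: (third_colour i j) => k ki kj.
  rewrite (_ : [set F | _] = [set face j u; face k u]).
    by apply: card_pair => /face_eqP[jk _]; rewrite jk eqxx in kj.
  apply/seteqP; split=> F /=.
    case=> /rank_dim/dim3[l [v ->]].
    rewrite comparable_sym comparable_edge_face => /andP[il /eqP uv].
    have [lj|lj] := eqVneq l j; [left|right]; apply/face_eqP; split=> //.
    by apply: (@third_colour_unique i j); rewrite // eq_sym.
  by case=> ->; (split; [exact/rank_dim/dim_face|]);
    rewrite comparable_sym comparable_edge_face eqxx eq_sym ?ji ?ki.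
- move=> V F /rank_dim/dim1[u ->] /rank_dim/dim3[i [v ->]].
  rewrite comparable_vert ?dim_face // s_face inE => /eqP uv.
  case: (third_colour i i) => j ji _; case: (third_colour i j) => k ki kj.
  rewrite (_ : [set E | _] = [set edge j u; edge k u]).
    by apply: card_pair => /edge_eq[jk _]; rewrite jk eqxx in kj.
  apply/seteqP; split=> E /=.
    case=> /rank_dim/dim2[l [w ->]].
    rewrite comparable_sym comparable_vert ?dim_edge // s_edge !inE => uw.
    rewrite comparable_edge_face => /andP[li _].
    have -> : edge l w = edge l u by case/orP: uw => /eqP->; rewrite ?edge_h.
    have [->|lj] := eqVneq l j; [by left|right].
    by congr edge; apply: (@third_colour_unique i j) => //; rewrite eq_sym.
  by case=> ->; (split; first exact/rank_dim/dim_edge);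
    rewrite ?comparable_edge_face ?uv ?eqxx ?ji ?ki //
      comparable_sym comparable_vert ?dim_edge // s_edge !inE eqxx.
Qed.

End Polyhedron.

(** * Automorphisms and coverings *)

Section Automorphisms.
Variables (d : Order.disp_t) (X : tbPOrderType d).

Lemma automorphism_inv (a : X -> X) : automorphism a ->
  exists b, [/\ automorphism b, cancel a b & cancel b a].
Proof.
case=> -[b ab ba] am; exists b; split=> //; split; first by exists a.
by move=> x y; rewrite -{2}(ba x) -{2}(ba y) am.
Qed.

Lemma automorphism_comp (a b : X -> X) :
  automorphism a -> automorphism b -> automorphism (b \o a).
Proof.
case=> abij am [bbij bm]; split; first exact: bij_comp.
by move=> x y /=; rewrite bm am.
Qed.

Lemma automorphism_flag (a : X -> X) (A : set X) :
  automorphism a -> is_flag A -> is_flag (a @` A).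
Proof.
move=> aut [Atot Amax]; case: (automorphism_inv aut) => b [[_ bm] ab ba].
case: aut => _ am; split=> [_ _ [x Ax <-] [y Ay <-]|B Btot sub].
  by rewrite !am; exact: Atot.
have bB : b @` B = A.
  apply: Amax => [_ _ [x Bx <-] [y By <-]|x Ax]; first by rewrite !bm; exact: Btot.
  by exists (a x); rewrite ?ab //; apply: sub; exists x.
rewrite -bB; apply/seteqP; split=> x.
  by move=> Bx; exists (b x); [exists x|rewrite ba].
by case=> _ [y By <-] <-; rewrite ba.
Qed.

(** The rank is computed in a flag, and automorphisms carry flags to flags. *)
Lemma automorphism_rank (a : X -> X) x i :
  automorphism a -> has_rank x i -> has_rank (a x) i.
Proof.
move=> aut [Psi [n [Px cn ->]]].
exists (SigSub (mem_set (automorphism_flag aut (set_valP Psi)))), n.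
split=> //; first by exists x.
suff : [set y | (a @` elements Psi) y /\ (y < a x)%O] #= `I_n by [].
have [[b ab _] am] := aut.
have -> : [set y | (a @` elements Psi) y /\ (y < a x)%O] =
          a @` [set y | elements Psi y /\ (y < x)%O].
  have alt y z : (a y < a z)%O = (y < z)%O by rewrite !lt_leAnge !am.
  apply/seteqP; split=> y.
    by case=> -[z Pz <-]; rewrite alt => zx; exists z.
  by case=> z [Pz zx] <-; split; [exists z|rewrite alt].
apply: card_eq_trans cn; apply: inj_card_eq => y z _ _; exact: (can_inj ab).
Qed.

End Automorphisms.

(** A word w is evaluated by [foldr f x w], its last letter acting first; reversing
    a word in involutions inverts it. *)
Lemma foldr_rev_cancel (T : Type) (f : 'I_3 -> T -> T) (x : T) w :
  (forall i, involutive (f i)) -> foldr f (foldr f x w) (rev w) = x.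
Proof.
move=> fK; elim: w x => //= i w IH x.
by rewrite rev_cons foldr_rcons fK.
Qed.

Lemma Mon_word d (Y : tbPOrderType d) w :
  Mon (fun Psi : flag Y => foldr (@adj _ Y) Psi w).
Proof.
move=> G [[_ Gid Gcomp _] adjG]; elim: w => [|i w Gw]; first exact: Gid.
by apply: (Gcomp (fun Psi => foldr (@adj _ Y) Psi w) (@adj _ Y i)) => //;
  apply: adjG; exists i.
Qed.

(** The map f is a morphism of coloured graphs up to the renaming p of the colours,
    so that it induces a map of flags commuting with the monodromy. *)
Definition coloured_map (U V : Type) (h : 'I_3 -> U -> U) (h' : 'I_3 -> V -> V)
    (f : U -> V) (p : 'S_3) : Prop :=
  forall i u, f (h i u) = h' (p i) (f u).

Definition flag_map (U V : Type) (f : U -> V) (p : 'S_3) (t : U * 'S_3) : V * 'S_3 :=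
  (f t.1, t.2 * p)%g.

Lemma flag_map_adj (U V : finType) (h : 'I_3 -> U -> U) (h' : 'I_3 -> V -> V)
    f p i t : coloured_map h h' f p ->
  flag_map f p (flag_adj h i t) = flag_adj h' i (flag_map f p t).
Proof.
move=> fh; move: t => [u q]; rewrite /flag_adj /flag_map; elim/ord3P: i => /=.
- by rewrite fh permM.
- by rewrite mulgA.
- by rewrite mulgA.
Qed.

Lemma flag_map_word (U V : finType) (h : 'I_3 -> U -> U) (h' : 'I_3 -> V -> V)
    f p t w :
  coloured_map h h' f p ->
  flag_map f p (foldr (flag_adj h) t w) = foldr (flag_adj h') (flag_map f p t) w.
Proof. by move=> fh; elim: w => //= i w <-; exact: flag_map_adj. Qed.

Section Symmetry.
Variables (U : finType) (L : eqType).
Variables (h : 'I_3 -> U -> U) (phi : 'I_3 -> U -> L).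
Hypothesis fc : face_colouring h phi.
Hypothesis face_conn :
  forall i u v, phi i u = phi i v -> reach h (predC1 i) u v.
Hypothesis conn : forall u v, reach h predT u v.
Variables (d : Order.disp_t) (X : tbPOrderType d) (s : X -> {set U}).
Hypothesis Xs : cell_poset h phi s.

Local Notation cell := (cell h phi).
Local Notation r := (flag_adj h).
Local Notation fl := (fl fc Xs).
Local Notation chain := (chain h phi s).

Definition coloured_auto (A : U -> U) (p : 'S_3) : Prop :=
  bijective A /\ coloured_map h h A p.

Lemma coloured_auto_comp A B p q : coloured_auto A p -> coloured_auto B q ->
  coloured_auto (B \o A) (p * q)%g.
Proof.
case=> Abij Ah [Bbij Bh]; split; first exact: bij_comp.
by move=> i u /=; rewrite Ah Bh permM.
Qed.

Lemma coloured_auto_inv A p : coloured_auto A p ->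
  exists B, [/\ coloured_auto B p^-1%g, cancel A B & cancel B A].
Proof.
case=> -[B AB BA] Ah; exists B; split=> //; split; first by exists A.
by move=> i u; apply: (can_inj AB); rewrite Ah permKV !BA.
Qed.

(** Faces are the components of the graph in two colours, hence they are carried to
    faces. *)
Lemma coloured_auto_phi A p i u v : coloured_auto A p ->
  phi i u = phi i v -> phi (p i) (A u) = phi (p i) (A v).
Proof.
case=> _ Ah /face_conn; apply: (reach_ind (P := fun w => _ = phi (p i) (A w))) => //.
by move=> j w ji ->; rewrite Ah (phi_h fc) // (inj_eq perm_inj).
Qed.

Lemma cell_image A p t k : coloured_auto A p ->
  (A @: cell t k)%SET = cell (flag_map A p t) k.
Proof.
move=> Aaut; case: (coloured_auto_inv Aaut) => B [Baut AB BA].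
case: (Aaut) => _ Ah; move: t => [u q].
case: k => [|[|[|[|k]]]]; rewrite ?cell_top /cell /flag_map /=.
- exact: imset0.
- exact: imset_set1.
- by rewrite /edge_set imsetU !imset_set1 Ah permM.
- apply/setP=> v; rewrite permM; apply/imsetP/idP=> [[w]|].
    by rewrite !inE => /eqP e ->; apply/eqP; exact: coloured_auto_phi.
  rewrite inE => /eqP e; exists (B v); rewrite ?BA // inE.
  by have := coloured_auto_phi Baut e; rewrite permK AB => ->.
- by apply/setP=> v; rewrite !inE; apply/imsetP; exists (B v); rewrite ?BA.
Qed.

Lemma coloured_auto_automorphism A p : coloured_auto A p ->
  exists2 a : X -> X, automorphism a &
    forall t, a @` chain t = chain (flag_map A p t).
Proof.
move=> Aaut; case: (coloured_auto_inv Aaut) => B [Baut AB BA].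
have ex C q x : coloured_auto C q -> exists y, s y = (C @: s x)%SET.
  move=> Caut; case: (cell_of Xs x) => t [k [_ ->]].
  by rewrite (cell_image _ _ Caut); exact: of_cell.
have [a aE] := choice (fun x => ex A p x Aaut).
have [b bE] := choice (fun x => ex B _ x Baut).
have ab : cancel a b.
  move=> x; apply: (cell_embed_inj Xs); rewrite bE aE -imset_comp.
  by rewrite (eq_imset _ AB) imset_id.
have ba : cancel b a.
  move=> x; apply: (cell_embed_inj Xs); rewrite aE bE -imset_comp.
  by rewrite (eq_imset _ BA) imset_id.
exists a.
  split; first by exists b.
  move=> x y; rewrite !(cell_le Xs) !aE; apply/idP/idP; last exact: imsetS.
  by move/(imsetS B); rewrite -!imset_comp !(eq_imset _ AB) !imset_id.
move=> t; apply/seteqP; split=> y.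
  by case=> x [k k5 sx] <-; exists k => //; rewrite aE sx (cell_image _ _ Aaut).
case=> k k5 sy; exists (elt h phi s t k); first exact: chain_elt.
by apply: (cell_embed_inj Xs); rewrite aE (eltE Xs) (cell_image _ _ Aaut).
Qed.

Variable u0 : U.
Let t0 : U * 'S_3 := (u0, 1%g).

(** The flag graph is connected: r_1 and r_2 generate all orderings of the colours
    at one vertex, and r_0 then moves along an edge of any colour. *)
Lemma flag_ind (O : U * 'S_3 -> Prop) :
  (forall i t, O t -> O (r i t)) -> O t0 -> forall t, O t.
Proof.
move=> Or O0; have Op u q p : O (u, q) -> O (u, p).
  have O3 (q1 q2 : 'S_3) : q1 c2 = q2 c2 -> O (u, q1) -> O (u, q2).
    move=> q12 Oq; have [q0|q1'|q2'] := perm3_values q1 (q2 c0).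
    - by rewrite -(@perm3_ext q1 q2 c0 c2).
    - rewrite (_ : (u, q2) = r c1 (u, q1)); first exact: Or.
      congr pair; apply: (@perm3_ext _ _ c0 c2) => //.
        by rewrite permM tpermL.
      by rewrite permM tpermD.
    - by move: q2'; rewrite q12 => /perm_inj.
  have O2 (q1 q2 : 'S_3) : q1 c1 = q2 c2 -> O (u, q1) -> O (u, q2).
    move=> q12 /(Or c2); apply: O3 => /=.
    by rewrite permM tpermR.
  move=> Oq; have [p0|p1|p2] := perm3_values q (p c2).
  - by move/(Or c1): Oq; apply: O2; rewrite /= permM tpermR p0.
  - exact: O2 Oq.
  - exact: O3 Oq.
case=> u p; apply: (Op u 1%g).
apply: (reach_ind (P := fun v => O (v, 1%g))) (conn u0 u) => [i v _ Ov|//].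
apply: (Op _ (tperm c0 i)).
by have := Or c0 _ (Op v 1%g (tperm c0 i) Ov); rewrite /flag_adj /= tpermL.
Qed.

Lemma flag_word t : exists w, t = foldr r t0 w.
Proof.
move: t; apply: flag_ind => [i _ [w ->]|]; first by exists (i :: w).
by exists [::].
Qed.

Hypothesis base_symmetric : forall i, exists A p,
  coloured_auto A p /\ flag_map A p t0 = r i t0.

(** It suffices to move the base flag to its three neighbours, since coloured
    automorphisms commute with the monodromy. *)
Lemma flag_transitive t :
  exists A p, coloured_auto A p /\ flag_map A p t0 = t.
Proof.
move: t; apply: flag_ind => [i _ [A [p [Aaut <-]]]|].
  case: (base_symmetric i) => B [q [Baut Bt0]].
  exists (A \o B), (q * p)%g; split; first exact: coloured_auto_comp.
  by rewrite -(flag_map_adj _ _ Aaut.2) -Bt0 /flag_map /= mulgA.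
by exists id, 1%g; rewrite /flag_map mulg1; split=> //; split=> [|? ?];
  [exact: inv_bij|rewrite perm1].
Qed.

(** The monodromy group commutes with a transitive group, hence acts freely. *)
Lemma word_free w w' : foldr r t0 w = foldr r t0 w' ->
  forall t, foldr r t w = foldr r t w'.
Proof.
move=> e t; case: (flag_transitive t) => A [p [Aaut <-]].
by rewrite -!(flag_map_word _ _ Aaut.2) e.
Qed.

Lemma cells_regular : regular_polyhedron X.
Proof.
split=> [|Psi Psi']; first exact: (cells_polyhedron fc Xs).
have [t ->] := fl_surj fc Xs Psi; have [t' ->] := fl_surj fc Xs Psi'.
case: (flag_transitive t) => A [p [Aaut tE]].
case: (flag_transitive t') => B [q [Baut t'E]].
have [a aaut aE] := coloured_auto_automorphism Aaut.
have [b baut bE] := coloured_auto_automorphism Baut.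
have [a' [a'aut aa' _]] := automorphism_inv aaut.
exists (b \o a'); first exact: automorphism_comp.
rewrite !elements_fl -tE -t'E -aE -bE image_comp.
by apply: eq_imagel => x _ /=; rewrite aa'.
Qed.

Lemma automorphism_chain a t : automorphism a ->
  exists t', a @` chain t = chain t'.
Proof.
by move=> aut; apply: (is_flagP fc Xs); apply: automorphism_flag => //;
  exact: chain_is_flag.
Qed.

(** Automorphisms preserve ranks, hence adjacency of flags. *)
Lemma automorphism_adj a i t t' : automorphism a ->
  a @` chain t = chain t' -> a @` chain (r i t) = chain (r i t').
Proof.
move=> aut aE; case: (automorphism_chain (r i t) aut) => t'' a'E.
rewrite a'E; suff -> : t'' = r i t' by [].
case: (automorphism_inv aut) => b [baut ab ba].
have [ne same] := (adjacent_fl fc Xs i t (r i t)).2 erefl.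
apply/(adjacent_fl fc Xs); split=> [e|x nx].
  apply: ne; apply: val_inj; rewrite /= -[LHS]image_id -[RHS]image_id.
  have := congr1 (fun Psi : flag X => b @` elements Psi) e.
  rewrite !elements_fl -aE -a'E !image_comp.
  by rewrite !(eq_imagel (f' := id)) // => y _ /=; rewrite ab.
have nbx : ~ has_rank (b x) i.
  by move=> /(automorphism_rank aut); rewrite ba.
have := same _ nbx; rewrite !elements_fl -aE -a'E => sameb.
have img (C : set X) : (a @` C) x <-> C (b x).
  by split=> [[y Cy <-]|Cbx]; [rewrite ab|exists (b x)].
by rewrite !img.
Qed.

Lemma automorphism_word a t t' w : automorphism a ->
  a @` chain t = chain t' -> a @` chain (foldr r t w) = chain (foldr r t' w).
Proof. by move=> aut aE; elim: w => //= i w; exact: automorphism_adj. Qed.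

(** An automorphism [a] moves the base flag as some word w does, and is sent to the
    inverse of w acting on the flags of Y.  The inverse is needed because words
    and automorphisms compose in opposite orders: if [a] and [b] correspond to w
    and w', then [b \o a] corresponds to w followed on the right by w'.  The word
    is determined by [a] up to relations between the r_i, which hold in Y by
    hypothesis. *)
Lemma cells_cover e (Y : tbPOrderType e) : (forall i, involutive (@adj _ Y i)) ->
  (forall w w', (forall t, foldr r t w = foldr r t w') ->
     forall Psi : flag Y, foldr (@adj _ Y) Psi w = foldr (@adj _ Y) Psi w') ->
  covers X Y.
Proof.
move=> adjK rel.
have ex (a : X -> X) : exists w, automorphism a ->
    a @` chain t0 = chain (foldr r t0 w).
  have [aut|naut] := pselect (automorphism a); last by exists [::].
  case: (automorphism_chain t0 aut) => t aE; case: (flag_word t) => w tE.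
  by exists w; rewrite -tE.
have [W WP] := choice ex.
have WE a w : automorphism a -> a @` chain t0 = chain (foldr r t0 w) ->
    forall Psi : flag Y, foldr (@adj _ Y) Psi (rev (W a)) =
                         foldr (@adj _ Y) Psi (rev w).
  move=> aut; rewrite WP // => e' Psi.
  have eW : foldr r t0 (W a) = foldr r t0 w.
    by apply: (fl_inj (fc := fc) (Xs := Xs)); exact: val_inj.
  have can w' := @foldr_rev_cancel _ (@adj _ Y) _ w' adjK.
  rewrite -[in RHS](foldr_rev_cancel Psi (rev (W a)) adjK) revK.
  by rewrite (rel _ _ (word_free eW)) can.
have [rho rhoP] : exists rho : 'I_3 -> X -> X, distinguished (fl t0) rho.
  have exrho i : exists a : X -> X,
      automorphism a /\ a @` elements (fl t0) = elements (adj i (fl t0)).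
    by case: cells_regular => _ /(_ (fl t0) (adj i (fl t0)))[a]; exists a.
  have [rho rhoP] := choice exrho; by exists rho.
exists (fl t0), rho, (fun a Psi => foldr (@adj _ Y) Psi (rev (W a))); split=> //.
- by move=> a _; exact: Mon_word.
- move=> a b aaut baut; apply/funext => Psi /=.
  rewrite -foldr_cat -rev_cat; apply: WE; first exact: automorphism_comp.
  rewrite -image_comp WP // (automorphism_word _ baut (WP b baut)).
  by rewrite foldr_cat.
- move=> i; apply/funext => Psi; have [rhoaut rhoE] := rhoP i.
  apply: (WE _ [:: i]) => //.
  by move: rhoE; rewrite adj_fl.
Qed.

End Symmetry.

Section Words.
Variables (d : Order.disp_t) (Y : tbPOrderType d).
Local Notation word w := (fun Psi : flag Y => foldr (@adj _ Y) Psi w).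

Hypothesis adjK : forall i, involutive (@adj _ Y i).

(** The words form a group because the adjacency maps are involutions. *)
Lemma MonP f : Mon f -> exists w, f = word w.
Proof.
move=> Mf; apply: (Mf [set f | exists w, f = word w]); split; last first.
  by move=> _ [i _ <-]; exists [:: i].
have can w : cancel (word w) (word (rev w)).
  by move=> Psi; exact: foldr_rev_cancel.
split.
- move=> _ [w ->]; exists (word (rev w)); first exact: can.
  by move=> Psi; have := can (rev w) Psi; rewrite revK.
- by exists [::].
- move=> _ _ [w ->] [w' ->]; exists (w' ++ w); apply/funext => Psi /=.
  by rewrite foldr_cat.
- move=> _ g [w ->] wg gw; exists (rev w); apply/funext => Psi.
  by rewrite -{2}(gw Psi) can.
Qed.

(** If every relation of the monodromy group of Y holds in that of X, then words
    define a homomorphism between the two groups. *)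
Lemma covers_trans_words e (P : tbPOrderType e) e' (X : tbPOrderType e') :
  (forall w w', (forall Psi : flag Y, word w Psi = word w' Psi) ->
    forall Psi : flag X, foldr (@adj _ X) Psi w = foldr (@adj _ X) Psi w') ->
  covers P Y -> covers P X.
Proof.
move=> rel [Phi [rho [phi [rhoP phiM phiC phiR]]]].
have ex f : exists w, Mon f -> f = word w.
  by have [/MonP[w ->]|nf] := pselect (Mon f); [exists w|exists [::]].
have [W WP] := choice ex.
exists Phi, rho, (fun a Psi => foldr (@adj _ X) Psi (W (phi a))); split=> //.
- by move=> a _; exact: Mon_word.
- move=> a b aaut baut; apply/funext => Psi /=; rewrite -foldr_cat.
  apply: (rel _ (W (phi b) ++ W (phi a))).
  move=> Psi'; rewrite foldr_cat.
  rewrite -[LHS](congr1 (@^~ Psi') (WP _ (phiM _ (automorphism_comp aaut baut)))).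
  rewrite -[RHS](congr1 (@^~ _) (WP _ (phiM _ baut))).
  by rewrite -(congr1 (@^~ Psi') (WP _ (phiM _ aaut))) phiC.
- move=> i; apply/funext => Psi; apply: (rel _ [:: i]) => Psi'.
  have eW := congr1 (@^~ Psi') (WP _ (phiM _ (rhoP i).1)).
  by transitivity (phi (rho i) Psi'); [exact: esym eW|rewrite phiR].
Qed.

End Words.

(** * Compactness of the surface *)

Lemma triangle_compact (R : realType) : compact (@triangle R : set 'rV[R]_3).
Proof.
have coord i : continuous (fun t : 'rV[R]_3 => t 0 i).
  exact: coord_continuous.
pose cube := [set t : 'rV[R]_3 | forall i, `[(0 : R), 1]%classic (t ord0 i)].
have cube_compact : compact cube.
  apply: (@rV_compact _ _ (fun=> `[(0 : R), 1]%classic)) => _.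
  exact: segment_compact.
apply: (subclosed_compact _ cube_compact) => [|t [t0 t1] i]; last first.
  rewrite /= in_itv /= t0 /= -t1 (bigD1 i) //= lerDl.
  by apply: sumr_ge0 => j _; exact: t0.
have -> : (@triangle R : set 'rV[R]_3) =
    (\bigcap_(i in [set: 'I_3]) [set t : 'rV[R]_3 | 0 <= t 0 i]) `&`
    [set t : 'rV[R]_3 | t 0 c0 + (t 0 c1 + t 0 c2) = 1].
  have sumE (t : 'rV[R]_3) : \sum_(i < 3) t 0 i = t 0 c0 + (t 0 c1 + t 0 c2).
    rewrite !big_ord_recl big_ord0 addr0.
    by congr (t 0 _ + (t 0 _ + t 0 _)); apply: val_inj.
  by apply/seteqP; split=> t /=; rewrite /triangle /= sumE => -[H ->]; split=> // i;
    [move=> _|]; exact: H.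
apply: closedI.
  apply: closed_bigI => i _.
  exact: (preimage_closed (fun t _ => coord i t) (@closed_ge R 0)).
pose sum3 (t : 'rV[R]_3) : R := t 0 c0 + (t 0 c1 + t 0 c2).
have sum3_continuous : continuous sum3.
  move=> t; pose x i (t : 'rV[R]_3) : R^o := t 0 i.
  exact: (@continuousD _ R^o _ (x c0) (x c1 + x c2) t (coord c0 t)
           (@continuousD _ R^o _ (x c1) (x c2) t (coord c1 t) (coord c2 t))).
exact: (preimage_closed (fun t _ => sum3_continuous t) (@closed_eq R 1)).
Qed.

(** A retraction of the space onto the subset, continuous along it, presents the
    subtype as a continuous image of the subset. *)
Lemma set_type_compact (T : topologicalType) (A : set T) :
  compact A -> compact [set: A].
Proof.
move=> cA; have [[a0 Aa0]|none] := pselect (exists a, A a); last first.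
  rewrite (_ : [set: A] = set0); first exact: compact0.
  by apply/seteqP; split=> // x; case: none; exists (set_val x); exact: set_valP.
pose f (x : T) : A := insubd (SigSub (mem_set Aa0) : A) x.
have fK x : A x -> set_val (f x) = x.
  by move=> Ax; apply: insubdK; exact: mem_set.
have -> : [set: A] = f @` A.
  apply/seteqP; split=> // x _; exists (set_val x); first exact: set_valP.
  by apply: val_inj; exact: fK (set_valP x).
apply: continuous_compact cA.
apply: (@continuous_comp_initial (set_type A) (subspace A) T set_val f).
apply: (@subspace_eq_continuous _ A _ (id : subspace A -> T)).
  by move=> x; rewrite inE => Ax; rewrite /= fK.
by apply: (@continuous_subspaceT _ _ A id) => x; exact: cvg_id.
Qed.

Lemma surface_compact (R : realType) d (P : tbPOrderType d) :
  finite_set [set: flag P] -> compact [set: surface R P].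
Proof.
move=> fin; have ctri : compact [set: triangles R P].
  apply: sigT_compact => // _; apply: (@set_type_compact _ (@triangle R)).
  exact: triangle_compact.
have -> : [set: surface R P] =
    (\pi_(surface R P)%qT : triangles R P -> surface R P) @` [set: triangles R P].
  by apply/seteqP; split=> // x _; exists (generic_quotient.repr x) => //;
    exact: generic_quotient.reprK.
apply: continuous_compact ctri; apply: continuous_subspaceT.
exact: pi_continuous.
Qed.

(** * Counting faces and orienting flags *)

Lemma card_image_finset (T : finType) (V : Type) (A : {set T}) (f : T -> V) :
  {in A &, injective f} -> f @` [set x | x \in A] #= `I_#|A|.
Proof.
move=> finj; have [->|[x0 x0A]] := set_0Vmem A.
  rewrite cards0 II0 (_ : [set x | _] = set0) ?image_set0 //.
  by apply/seteqP; split=> x //=; rewrite inE.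
have -> : f @` [set x | x \in A] = (fun i => f (nth x0 (enum A) i)) @` `I_#|A|.
  apply/seteqP; split=> y; case=> x /= Hx <-; last first.
    by exists (nth x0 (enum A) x) => //=; rewrite -mem_enum mem_nth // -cardE.
  exists (index x (enum A)); last by rewrite nth_index ?mem_enum.
  by rewrite /= cardE index_mem mem_enum.
apply: inj_card_eq => i j; rewrite !inE /= => iA jA.
have inA k : (k < #|A|)%N -> nth x0 (enum A) k \in A.
  by move=> kA; rewrite -mem_enum mem_nth // -cardE.
move/finj => /(_ (inA _ iA) (inA _ jA))/eqP.
by rewrite nth_uniq ?enum_uniq -?cardE // => /eqP.
Qed.

Section Counting.
Variables (U : finType) (L : finType).
Variables (h : 'I_3 -> U -> U) (phi : 'I_3 -> U -> L) (par : U -> bool).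
Hypothesis fc : face_colouring h phi.
Hypothesis par_h : forall i u, par (h i u) = ~~ par u.
Hypothesis phi_surj : forall i l, exists u, phi i u = l.
Variables (d : Order.disp_t) (X : tbPOrderType d) (s : X -> {set U}).
Hypothesis Xs : cell_poset h phi s.

Lemma card_vertices : faces_of_rank X 0 #= `I_#|U|.
Proof.
rewrite -cardsT (_ : faces_of_rank X 0 =
    vert h phi s @` [set u | u \in [set: U]%SET]).
  by apply: card_image_finset => u v _ _; exact: vert_inj.
apply/seteqP; split=> x.
  by move/(rank_dim fc Xs)/(dim1 fc Xs) => [u ->]; exists u; rewrite /= ?inE.
by case=> u _ <-; apply/(rank_dim fc Xs)/dim_vert.
Qed.

Let half := [set u | ~~ par u]%SET.

(** Moving along the edges of colour 0 exchanges the two parities. *)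
Lemma card_half : #|U| = (2 * #|half|)%N.
Proof.
have hhalf : (h c0 @: half)%SET = (~: half)%SET.
  apply/setP=> u; rewrite !inE negbK; apply/imsetP/idP => [[v]|pu].
    by rewrite inE => pv ->; rewrite par_h.
  by exists (h c0 u); rewrite ?inE ?par_h ?pu ?(hK fc).
rewrite -(cardsC half) -hhalf card_imset ?mul2n ?addnn //.
exact: (h_inj fc).
Qed.

(** Each edge is counted at its end of even parity. *)
Lemma card_edges : faces_of_rank X 1 #= `I_(3 * #|half|).
Proof.
pose D := finset.setX [set: 'I_3]%SET half.
have -> : (3 * #|half| = #|D|)%N by rewrite cardsX cardsT card_ord.
rewrite (_ : faces_of_rank X 1 =
    (fun iu => edge h phi s iu.1 iu.2) @` [set iu | iu \in D]).
  apply: card_image_finset => -[i u] [j v]; rewrite !inE /= => pu pv.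
  case/(edge_eq fc Xs) => <- [->//|vE].
  by move: pv; rewrite vE par_h pu.
apply/seteqP; split=> x.
  move/(rank_dim fc Xs)/(dim2 fc Xs) => [i [u ->]].
  have [pu|pu] := boolP (par u).
    by exists (i, h i u); rewrite /= ?(edge_h fc Xs) // !inE par_h pu.
  by exists (i, u); rewrite //= !inE pu.
by case=> -[i u] _ <-; apply/(rank_dim fc Xs)/dim_edge.
Qed.

Lemma card_faces : faces_of_rank X 2 #= `I_(3 * #|L|).
Proof.
have ex (il : 'I_3 * L) : exists u, phi il.1 u = il.2 by exact: phi_surj.
have [rep repE] := choice ex.
have -> : (3 * #|L| = #|[set: 'I_3 * L]%SET|)%N by rewrite cardsT card_prod card_ord.
rewrite (_ : faces_of_rank X 2 =
    (fun il => face h phi s il.1 (rep il)) @` [set il | il \in [set: 'I_3 * L]%SET]).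
  apply: card_image_finset => -[i l] [j m] _ _.
  case/(face_eqP fc Xs) => /= ij e; subst j.
  by have := repE (i, l); rewrite /= e (repE (i, m)) /= => ->.
apply/seteqP; split=> x.
  move/(rank_dim fc Xs)/(dim3 fc Xs) => [i [u ->]].
  exists (i, phi i u); first by rewrite /= inE.
  by apply/(face_eqP fc Xs); rewrite repE.
by case=> -[i u] _ <-; apply/(rank_dim fc Xs)/dim_face.
Qed.

Lemma finite_flags : finite_set [set: flag X].
Proof.
exists #|[set: U * 'S_3]%SET|.
rewrite (_ : [set: flag X] = fl fc Xs @` [set t | t \in [set: U * 'S_3]%SET]).
  by apply: card_image_finset => t t' _ _; exact: fl_inj.
apply/seteqP; split=> // Psi _; have [t ->] := fl_surj fc Xs Psi.
by exists t; rewrite //= inE.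
Qed.

(** The parity of the vertex plus the sign of the colour ordering changes between
    adjacent flags; it decides between the two cyclic orders of the corners, which
    are mutually inverse. *)
Lemma cells_orientable : orientable X.
Proof.
have [f fE] := choice (fl_surj fc Xs).
have fK t : f (fl fc Xs t) = t by apply: (fl_inj (fc := fc) (Xs := Xs)).
pose colour (t : U * 'S_3) := par t.1 (+) odd_perm t.2.
have colour_r i t : colour (flag_adj h i t) = ~~ colour t.
  move: t => [u p]; rewrite /colour /flag_adj; elim/ord3P: i => /=.
  - by rewrite par_h addNb.
  - by rewrite odd_permM odd_tperm addbA addbT -addNb.
  - by rewrite odd_permM odd_tperm addbA addbT -addNb.
pose c : 'S_3 := perm (addIr (1 : 'I_3)).
have cN j : c j != j by rewrite permE; elim/ord3P: j.
have cVN j : (c^-1)%g j != j by rewrite -(inj_eq (@perm_inj _ c)) permKV eq_sym.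
exists (fun Psi => if colour (f Psi) then c else (c^-1)%g);
  split=> [Psi j|Psi i j _ _].
  by case: ifP.
rewrite [in adj i Psi](fE Psi) adj_fl fK colour_r.
by case: (colour (f Psi)) => /=; rewrite ?permK ?permKV.
Qed.

End Counting.

(** * The coloured graph of the cover *)

Section CubicGraph.
Variable n : nat.
Local Notation Z := 'I_n.+1.

(** With m = n + 1, a vertex is an element of the group generated by h_0, h_1, h_2
    inside a product of three dihedral groups of order 4m.  The booleans are the
    parities of the numbers of letters of the three colours.  The dihedral group
    with index i sees only the two colours other than i; its elements are the
    positions on a 4m-cycle, 4 times a residue modulo m plus a position in 0, 1,
    2, 3 that the two parities determine. *)
Definition cover_vertex : Type := ((bool * bool * bool) * (Z * Z * Z))%type.
HB.instance Definition _ := Finite.on cover_vertex.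

Definition unit_of (b : bool) : Z := if b then inZp 1 else 0.

(** The threefold symmetry which renames the colours cyclically; everything else is
    defined for colour 0 and transported by it. *)
Definition turn (u : cover_vertex) : cover_vertex :=
  let: ((x, y, z), (a, b, c)) := u in ((y, z, x), (b, c, a)).

Definition turnV (u : cover_vertex) : cover_vertex :=
  let: ((x, y, z), (a, b, c)) := u in ((z, x, y), (c, a, b)).

Lemma turnK : cancel turn turnV. Proof. by case=> [[[x y] z] [[a b] c]]. Qed.
Lemma turnVK : cancel turnV turn. Proof. by case=> [[[x y] z] [[a b] c]]. Qed.
Lemma turn3 u : turn (turn u) = turnV u.
Proof. by case: u => [[[x y] z] [[a b] c]]. Qed.

(** A letter of colour 0 crosses a multiple of 4 only on the cycle with index 1, and
    only when the parity z of colour 2 is even there: the four positions of a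
    block follow the Gray code of the two parities. *)
Definition flip0 (u : cover_vertex) : cover_vertex :=
  let: ((x, y, z), (a, b, c)) := u in
  ((~~ x, y, z),
   (a, if z then b else if x then b + unit_of true else b - unit_of true, c)).

(** The invariants of the letters of colours 1 and 2.  A letter of colour 1 changes
    [c] only when x is even, and then by 1 in the direction given by y, so that
    the correction makes the last entry constant. *)
Definition face_label0 (u : cover_vertex) : bool * (Z * Z) :=
  let: ((x, y, z), (a, b, c)) := u in (x, (b, c + unit_of (~~ x && y))).

Definition flip (i : 'I_3) (u : cover_vertex) : cover_vertex :=
  match val i with
  | 0 => flip0 u
  | 1 => turnV (flip0 (turn u))
  | _ => turn (flip0 (turnV u))
  end.

Definition face_label (i : 'I_3) (u : cover_vertex) : bool * (Z * Z) :=
  match val i with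
  | 0 => face_label0 u
  | 1 => face_label0 (turn u)
  | _ => face_label0 (turnV u)
  end.

Definition parity (u : cover_vertex) : bool :=
  let: ((x, y, z), _) := u in x (+) y (+) z.

Lemma flip_parity i u : parity (flip i u) = ~~ parity u.
Proof.
by case: u => [[[x y] z] [[a b] c]]; elim/ord3P: i => /=; case: x; case: y; case: z.
Qed.

Lemma flip_colouring : face_colouring flip face_label.
Proof.
split.
- move=> i [[[x y] z] [[a b] c]]; elim/ord3P: i; rewrite /flip /=;
    case: x; case: y; case: z; rewrite /= ?addrK ?subrK //.
- move=> i j [[[x y] z] [[a b] c]]; elim/ord3P: i; elim/ord3P: j => //= _;
    rewrite /flip /face_label /=;
    case: x; case: y; case: z; rewrite /= ?addr0 ?addrK ?subrK //.
- move=> i [[[x y] z] [[a b] c]]; elim/ord3P: i; rewrite /flip /face_label /=;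
    by case: x; case: y; case: z; rewrite xpair_eqE.
Qed.

Lemma label_surj i l : exists u, face_label i u = l.
Proof.
case: l => x [b c]; pose u : cover_vertex := ((x, false, false), (0, b, c)).
have u0 : face_label0 u = (x, (b, c)) by rewrite /= andbF addr0.
by elim/ord3P: i; [exists u|exists (turnV u)|exists (turn u)];
  rewrite /face_label /= ?turnVK ?turnK.
Qed.

(** The renaming of colours i to i - 1, induced by [turn]. *)
Definition shift : 'S_3 := perm (addIr (-1 : 'I_3)).

Lemma turn_flip i u : turn (flip i u) = flip (shift i) (turn u).
Proof.
by rewrite permE; elim/ord3P: i; rewrite /flip /= ?turnVK ?turnK // ?turn3.
Qed.

Lemma turn_auto : coloured_auto flip turn shift.
Proof. by split; [exists turnV; [exact: turnK|exact: turnVK]|exact: turn_flip]. Qed.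

Lemma reflectK (v : Z) : involutive (fun b : Z => - b - v).
Proof. by move=> b; rewrite opprB opprK addrAC subrr add0r. Qed.

(** The symmetry exchanging the origin with its neighbour of colour 0.  In cycle
    positions it is the pair of reflections p to -1 - p and p to 1 - p. *)
Definition half_turn (u : cover_vertex) : cover_vertex :=
  let: ((x, y, z), (a, b, c)) := u in
  ((~~ x, y, z), (a, - b - unit_of true, - c - unit_of y)).

(** The reflection fixing the origin and exchanging colours 1 and 2: it negates the
    positions on the three cycles and exchanges two of the cycles.  Negating a
    position negates its residue, and decreases it by 1 more unless the position
    is a multiple of 4, that is, unless both of its parities are even. *)
Definition mirror (u : cover_vertex) : cover_vertex :=
  let: ((x, y, z), (a, b, c)) := u in
  ((x, z, y),
   (- a - unit_of (y || z), - c - unit_of (x || y), - b - unit_of (z || x))).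

Lemma cover_vertex_eq (p : bool * bool * bool) (a b c a' b' c' : Z) :
  a = a' -> b = b' -> c = c' -> (p, (a, b, c)) = (p, (a', b', c')).
Proof. by move=> -> -> ->. Qed.

Lemma half_turn_auto : coloured_auto flip half_turn 1%g.
Proof.
split.
  by apply: inv_bij => -[[[x y] z] [[a b] c]] /=;
    rewrite negbK ![- (- _ - _) - _]reflectK.
move=> i [[[x y] z] [[a b] c]]; rewrite perm1; elim/ord3P: i; rewrite /flip /=;
  by case: x; case: y; case: z; apply: cover_vertex_eq;
    rewrite /= ?subr0 ?addr0 ?opprB ?opprD ?opprK ?(addrC (inZp 1)) ?addrK ?subrK //
      addrAC ?addrK ?subrK.
Qed.

Lemma mirror_auto : coloured_auto flip mirror (tperm c1 c2).
Proof.
split.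
  by apply: inv_bij => -[[[x y] z] [[a b] c]] /=;
    rewrite (orbC z y) (orbC z x) (orbC x y) ![- (- _ - _) - _]reflectK.
move=> i [[[x y] z] [[a b] c]]; elim/ord3P: i;
  rewrite ?tpermL ?tpermR ?tpermD // /flip /=;
  by case: x; case: y; case: z; apply: cover_vertex_eq;
    rewrite /= ?subr0 ?addr0 ?opprB ?opprD ?opprK ?(addrC (inZp 1)) ?addrK ?subrK //
      addrAC ?addrK ?subrK.
Qed.

Definition origin : cover_vertex := ((false, false, false), (0, 0, 0)).

(** The neighbours of the base flag are its images under [half_turn], a conjugate of
    [mirror] by [turn], and [mirror]. *)
Lemma origin_symmetric i : exists A p,
  coloured_auto flip A p /\
  flag_map A p (origin, 1%g) = flag_adj flip i (origin, 1%g).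
Proof.
have fix0 : mirror origin = origin by rewrite /= /origin !subr0 !oppr0.
elim/ord3P: i; rewrite /flag_adj /flag_map /= ?mul1g ?mulg1.
- exists half_turn, 1%g; split; first exact: half_turn_auto.
  by rewrite perm1 mulg1 /flip /= subr0 !oppr0.
- exists (turn \o mirror \o turnV), (tperm c0 c1).
  split; last first.
    by congr pair; rewrite ?mul1g ?mulg1 /comp ?(fix0 : mirror (turnV origin) = origin).
  have [B [Baut turnB _]] := coloured_auto_inv turn_auto.
  have turnVaut : coloured_auto flip turnV shift^-1%g.
    by rewrite (_ : turnV = B) //; apply/funext => u; rewrite -{2}[u]turnVK turnB.
  have -> : tperm c0 c1 = (shift^-1 * tperm c1 c2 * shift)%g.
    apply: (mulgI shift); rewrite !mulgA mulgV mul1g; apply/permP => x.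
    by rewrite !permM !permE /=; elim/ord3P: x; apply: val_inj.
  exact: coloured_auto_comp (coloured_auto_comp turnVaut mirror_auto) turn_auto.
- exists mirror, (tperm c1 c2); split; first exact: mirror_auto.
  by rewrite mul1g fix0.
Qed.

Lemma reach_sub (D D' : pred 'I_3) u v : (forall i, D i -> D' i) ->
  reach flip D u v -> reach flip D' u v.
Proof.
move=> DD'; apply: (reach_ind (P := reach flip D' u)); last exact: connect0.
by move=> i w /DD' Di uw; apply: connect_trans uw (reach_step _ _ Di).
Qed.

Lemma reach_sym (D : pred 'I_3) u v : reach flip D u v -> reach flip D v u.
Proof.
apply: (reach_ind (P := fun w => reach flip D w u)); last exact: connect0.
move=> i w Di; apply: connect_trans.
by rewrite -{2}[w](hK flip_colouring i); exact: reach_step.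
Qed.

Lemma reach_turn i u v :
  reach flip (predC1 (shift i)) (turn u) (turn v) -> reach flip (predC1 i) u v.
Proof.
rewrite -{2}[u]turnK -{2}[v]turnK.
apply: (reach_ind (P := fun w => reach flip (predC1 i) _ (turnV w)));
  last exact: connect0.
move=> j w ji /connect_trans; apply.
have -> : turnV (flip j w) = flip (shift^-1 j)%g (turnV w).
  by apply: (can_inj turnK); rewrite turnVK turn_flip turnVK permKV.
by apply: reach_step; rewrite /= -(inj_eq (@perm_inj _ shift)) permKV.
Qed.

Lemma label_turn i u : face_label (shift i) (turn u) = face_label i u.
Proof.
by rewrite permE; elim/ord3P: i; rewrite /face_label /= ?turnVK ?turnK ?turn3.
Qed.

(** The face label determines this normal form.  The two parities are cleared by one
    letter each, and the four-letter word in colours 1 and 2 winds once around the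
    cycle with index 0, changing [a] by 1. *)
Lemma reach_normal x y z a b c :
  reach flip (predC1 c0) ((x, y, z), (a, b, c))
    ((x, false, false), (0, b, c + unit_of (~~ x && y))).
Proof.
have step i w : i != c0 -> reach flip (predC1 c0) w (flip i w) by exact: reach_step.
have clear_z : exists a', reach flip (predC1 c0) ((x, y, z), (a, b, c))
    ((x, y, false), (a', b, c)).
  case: z; last by exists a; exact: connect0.
  by exists (if y then a else a + unit_of true); exact: (step c2).
have clear_y a' : reach flip (predC1 c0) ((x, y, false), (a', b, c))
    ((x, false, false), (a', b, c + unit_of (~~ x && y))).
  case: y {clear_z}; last by rewrite andbF addr0; exact: connect0.
  have := step c1 ((x, true, false), (a', b, c)) isT.
  by case: x; rewrite /flip /= ?addr0.
have shift_a a' c' : reach flip (predC1 c0) ((x, false, false), (a', b, c'))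
    ((x, false, false), (a' + inZp 1, b, c')).
  have := connect_trans
    (connect_trans (step c1 ((x, false, false), (a', b, c')) isT) (step c2 _ isT))
    (connect_trans (step c1 _ isT) (step c2 _ isT)).
  by rewrite /flip /=; case: x {step clear_z clear_y} => /=; rewrite ?subrK.
have shift_to0 a' c' : reach flip (predC1 c0) ((x, false, false), (a', b, c'))
    ((x, false, false), (0, b, c')).
  have [k kE] : exists k, a' + inZp k = 0.
    by exists (- a'); rewrite (_ : inZp _ = - a') ?subrr //; exact: valZpK.
  rewrite -kE; elim: k {kE} => [|k IH].
    by rewrite (_ : inZp 0 = 0) ?addr0; [exact: connect0|exact: val_inj].
  rewrite (_ : inZp k.+1 = inZp k + inZp 1) ?addrA.
    by apply: connect_trans IH _; exact: shift_a.
  by apply: val_inj; rewrite /= modnDm addn1.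
have [a' za'] := clear_z.
exact: connect_trans za' (connect_trans (clear_y a') (shift_to0 a' _)).
Qed.

Lemma label_connected i u v :
  face_label i u = face_label i v -> reach flip (predC1 i) u v.
Proof.
have base w w' : face_label c0 w = face_label c0 w' -> reach flip (predC1 c0) w w'.
  move: w w' => [[[x y] z] [[a b] c]] [[[x' y'] z'] [[a' b'] c']].
  move/eqP; rewrite /face_label /= !xpair_eqE => /and3P[/eqP xx /eqP bb /eqP cc].
  subst x' b'; apply: connect_trans (reach_normal x y z a b c) _.
  by rewrite cc; apply: reach_sym; exact: reach_normal.
have next j w w' : j = c1 -> face_label j w = face_label j w' ->
    reach flip (predC1 j) w w'.
  move=> j1 e; apply: reach_turn.
  have -> : shift j = c0 by rewrite j1 permE; apply: val_inj.
  by apply: base; rewrite -(_ : shift j = c0) ?label_turn // j1 permE; apply: val_inj.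
elim/ord3P: i; [exact: base|exact: next|move=> e].
apply: reach_turn; have s2 : shift c2 = c1 by rewrite permE; apply: val_inj.
by apply: next => //; rewrite !label_turn.
Qed.

Lemma flip_connected u v : reach flip predT u v.
Proof.
have move_to i w w' : face_label i w = face_label i w' -> reach flip predT w w'.
  by move/label_connected; exact: reach_sub.
suff to0 w : reach flip predT w origin.
  by apply: connect_trans (to0 u) _; apply: reach_sym.
move: w => [[[x y] z] [[a b] c]].
pose b' := b + unit_of (~~ z && x).
have m1 := move_to c2 ((x, y, z), (a, b, c)) ((false, false, z), (a, b', 0)).
have m2 := move_to c0 ((false, false, z), (a, b', 0))
  ((false, false, false), (0, b', 0)).
have m3 := move_to c1 ((false, false, false), (0, b', 0)) origin.
apply: connect_trans (m1 _) (connect_trans (m2 _) (m3 _)) => //.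
by rewrite /face_label /= andbF addr0.
Qed.

Lemma card_cover_vertex : #|{: cover_vertex}| = (8 * n.+1 ^ 3)%N.
Proof. by rewrite !card_prod card_bool card_ord; nia. Qed.

Lemma card_label : #|{: bool * (Z * Z)}| = (2 * n.+1 ^ 2)%N.
Proof. by rewrite !card_prod card_bool card_ord; nia. Qed.

End CubicGraph.

(** * The poset of cells of a coloured graph *)

Section CellLattice.
Variables (U : finType) (L : eqType).
Variables (h : 'I_3 -> U -> U) (phi : 'I_3 -> U -> L).

Definition is_cell (S : {set U}) : bool :=
  [|| S == finset.set0, S == [set: U]%SET
    | [exists t : U * 'S_3, exists k : 'I_5, S == cell h phi t k]].

Record cells : Type := Cells { cell_set : {set U}; _ : is_cell cell_set }.

HB.instance Definition _ := [isSub for cell_set].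
HB.instance Definition _ := [Finite of cells by <:].

Definition cells_le : rel cells := fun x y => cell_set x \subset cell_set y.

Fact cells_le_refl : reflexive cells_le.
Proof. by move=> x; exact: fintype.subxx. Qed.

Fact cells_le_anti : antisymmetric cells_le.
Proof. by move=> x y xy; apply/val_inj/eqP; rewrite finset.eqEsubset. Qed.

Fact cells_le_trans : transitive cells_le.
Proof. by move=> y x z; exact: fintype.subset_trans. Qed.

HB.instance Definition _ :=
  Order.Le_isPOrder.Build Order.SetSubsetOrder.subset_display cells
    cells_le_refl cells_le_anti cells_le_trans.

Fact is_cell0 : is_cell finset.set0. Proof. by rewrite /is_cell eqxx. Qed.

Fact is_cellT : is_cell [set: U]%SET. Proof. by rewrite /is_cell eqxx orbT. Qed.

Fact cells_ge_bottom (x : cells) : (Cells is_cell0 <= x)%O.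
Proof. exact: finset.sub0set. Qed.

Fact cells_le_top (x : cells) : (x <= Cells is_cellT)%O.
Proof. exact: finset.subsetT. Qed.

HB.instance Definition _ :=
  Order.hasBottom.Build Order.SetSubsetOrder.subset_display cells
    cells_ge_bottom.
HB.instance Definition _ :=
  Order.hasTop.Build Order.SetSubsetOrder.subset_display cells
    cells_le_top.

Lemma cells_cell_poset (u0 : U) : cell_poset h phi cell_set.
Proof.
split=> [//|[S SP]|t k].
- case/or3P: (SP) => [/eqP S0|/eqP ST|]; first by exists (u0, 1%g), 0.
    by exists (u0, 1%g), 4.
  by case/existsP=> t /existsP[k /eqP SE]; exists t, k.
- have Sk : is_cell (cell h phi t k).
    have [k5|k5] := ltnP k 5; last first.
      by rewrite /is_cell -(subnKC k5) cell_top eqxx orbT.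
    by apply/or3P/Or33/existsP; exists t; apply/existsP; exists (Ordinal k5).
  by exists (Cells Sk).
Qed.

End CellLattice.

(** * The prism as a coloured graph *)

Section Prism.
Variable n : nat.
Hypotheses (n_even : ~~ odd n) (n_gt3 : (3 < n)%N).

(** The two perfect matchings of the rim: [up] joins each even position to the next
    one, [down] each odd position to the next one. *)
Definition up (i : 'I_n) : 'I_n := if odd i then ord_pred i else ordS i.
Definition down (i : 'I_n) : 'I_n := if odd i then ordS i else ord_pred i.

Definition prism_flip (c : 'I_3) (x : bool * 'I_n) : bool * 'I_n :=
  match val c with
  | 0 => (~~ x.1, x.2)
  | 1 => (x.1, up x.2)
  | _ => (x.1, down x.2)
  end.

(** The faces of colour 0 are the two rims.  The square over positions i and i + 1 is
    labelled by halving: i / 2 for even i, where it has colour 2, and half of i + 1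
    modulo n for odd i, where it has colour 1. *)
Definition prism_label (c : 'I_3) (x : bool * 'I_n) : nat :=
  match val c with
  | 0 => nat_of_bool x.1
  | 1 => (ordS x.2)./2
  | _ => x.2./2
  end.

Lemma ordS_val (i : 'I_n) : ordS i = (if i.+1 == n then 0 else i.+1)%N :> nat.
Proof.
rewrite /=; case: eqP => [->|ne]; first by rewrite modnn.
by rewrite modn_small // ltn_neqAle ltn_ord andbT; apply/eqP.
Qed.

Lemma ord_pred_val (i : 'I_n) :
  ord_pred i = (if i == 0%N :> nat then n.-1 else i.-1) :> nat.
Proof.
rewrite /=; case: eqP => [->|ne]; first by rewrite add0n modn_small //; lia.
have := ltn_ord i; have -> : (i + n).-1 = (i.-1 + n)%N by lia.
by rewrite modnDr => ltin; rewrite modn_small //; lia.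
Qed.

Lemma odd_ordS (i : 'I_n) : odd (ordS i) = ~~ odd i.
Proof. by rewrite ordS_val; move: n_even; case: eqP; lia. Qed.

Lemma odd_ord_pred (i : 'I_n) : odd (ord_pred i) = ~~ odd i.
Proof. by rewrite -{2}(ord_predK i) odd_ordS negbK. Qed.

Lemma up_ordS (i : 'I_n) : ~~ odd i -> up i = ordS i.
Proof. by rewrite /up => /negPf->. Qed.

Lemma upK : involutive up.
Proof.
move=> i; rewrite /up; case oi: (odd i); first by rewrite odd_ord_pred oi ord_predK.
by rewrite odd_ordS oi ordSK.
Qed.

Lemma downK : involutive down.
Proof.
move=> i; rewrite /down; case oi: (odd i); first by rewrite odd_ordS oi ordSK.
by rewrite odd_ord_pred oi ord_predK.
Qed.

Lemma up_val (i : 'I_n) : up i = (if odd i then i.-1 else i.+1) :> nat.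
Proof.
have := ltn_ord i; move: n_even; rewrite /up.
by case: ifP => oi; rewrite ?ordS_val ?ord_pred_val; case: eqP; lia.
Qed.

Lemma down_val (i : 'I_n) : down i =
  (if odd i then if i.+1 == n then 0%N else i.+1
   else if i == 0%N :> nat then n.-1 else i.-1) :> nat.
Proof. by rewrite /down; case: ifP => _; rewrite ?ordS_val ?ord_pred_val. Qed.

Lemma half_up (i : 'I_n) : (up i)./2 = i./2.
Proof. by rewrite up_val; case: ifP; lia. Qed.

Lemma half_ordS_down (i : 'I_n) : (ordS (down i))./2 = (ordS i)./2.
Proof.
rewrite /down; case: ifP => oi; last first.
  rewrite ord_predK -(half_up i) up_ordS ?oi //.
by rewrite -[in RHS](half_up (ordS i)) up_ordS ?odd_ordS ?oi.
Qed.

Lemma half_down_neq (i : 'I_n) : (down i)./2 != i./2.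
Proof.
by have := ltn_ord i; rewrite down_val; case: ifP => oi; do 2!case: eqP; lia.
Qed.

Lemma half_ordS_up_neq (i : 'I_n) : (ordS (up i))./2 != (ordS i)./2.
Proof.
rewrite /up; case: ifP => oi.
  by rewrite ord_predK eq_sym; have := half_down_neq i; rewrite /down oi.
have := half_down_neq (ordS i); rewrite /down odd_ordS oi //.
Qed.

Lemma prism_colouring : face_colouring prism_flip prism_label.
Proof.
split.
- move=> c [b i]; elim/ord3P: c; rewrite /prism_flip /=.
  + by rewrite negbK.
  + by rewrite upK.
  + by rewrite downK.
- by move=> c c' [b i]; elim/ord3P: c; elim/ord3P: c' => //= _;
    rewrite /prism_label /prism_flip /= ?half_up -/(ordS _) ?half_ordS_down.
- move=> c [b i]; elim/ord3P: c; rewrite /prism_label /prism_flip.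
  + by case: b.
  + exact: half_ordS_up_neq.
  + exact: half_down_neq.
Qed.

Lemma prism_rim b (i : 'I_n) :
  [set (b, i); (b, ordS i)]%SET =
  edge_set prism_flip (if odd i then c2 else c1) (b, i).
Proof.
by rewrite /edge_set /prism_flip /up /down; case: ifP => oi; rewrite /= ?oi.
Qed.

Lemma prism_square b (i : 'I_n) :
  [set x : bool * 'I_n | x.2 \in [:: i; ordS i]]%SET =
  face_set prism_label (if odd i then c1 else c2) (b, i).
Proof.
have l1 b' j : prism_label c1 (b', j) = (ordS j)./2 by [].
have l2 b' j : prism_label c2 (b', j) = j./2 by [].
apply/setP=> -[b' j]; rewrite !inE [_.2]/= -(inj_eq val_inj j i).
have -> : (j == ordS i) = (j == (if i.+1 == n then 0 else i.+1)%N :> nat).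
  by rewrite -ordS_val.
rewrite [val j]/= [val i]/=.
move: (ltn_ord i) (ltn_ord j) n_even n_gt3.
case oi: (odd i); rewrite ?l1 ?l2 ?ordS_val.
  by do 5!case: eqP; lia.
by do 4!case: eqP; lia.
Qed.

Lemma prism_cell_poset :
  cell_poset prism_flip prism_label (@prism_vertices n).
Proof.
have fc := prism_colouring; have n_gt0 : (0 < n)%N by exact: ltn_trans n_gt3.
pose i0 := Ordinal n_gt0.
split=> [//|[A AP]|[[b i] p] k].
- rewrite [prism_vertices _]/=; case/or4P: AP =>
    [/eqP->|/existsP[x /eqP->]|/existsP[b /existsP[i /eqP->]]|].
  + by exists ((false, i0), 1%g), 0.
  + by exists (x, 1%g), 1.
  + exists ((b, i), tperm c0 (if odd i then c2 else c1)), 2; split=> //.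
    by rewrite /= prism_rim /cell /= tpermL.
  case/or4P=> [/existsP[i /eqP->]|/existsP[b /eqP->]|/existsP[i /eqP->]|/eqP->].
  + by exists ((false, i), 1%g), 2; split=> //; rewrite /cell /= perm1.
  + exists ((b, i0), tperm c2 c0), 3; split=> //; rewrite /cell /= tpermL.
    by apply/setP=> x; rewrite !inE /prism_label /=; case: x.1; case: b.
  + exists ((false, i), tperm c2 (if odd i then c1 else c2)), 3; split=> //.
    by rewrite /cell /= tpermL (prism_square false).
  + by exists ((false, i0), 1%g), 4.
- suff cP : prism_face (cell prism_flip prism_label ((b, i), p) k).
    by exists (Prism cP).
  case: k => [|[|[|[|k]]]]; rewrite ?cell_top /cell /=.
  + exact: prism_face0.
  + by apply/or4P/Or42/existsP; exists (b, i).
  + have rim (c : 'I_3) (j : 'I_n) : (odd j = (c == c2)) -> c != c0 ->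
        prism_face (edge_set prism_flip c (b, j)).
      move=> oj c_neq0; apply/or4P/Or43/existsP; exists b; apply/existsP; exists j.
      by rewrite prism_rim oj; move: c_neq0 {oj}; elim/ord3P: c.
    elim/ord3P: (p c0).
    * apply/or4P/Or44/or4P/Or41/existsP; exists i; apply/eqP.
      by rewrite /edge_set /prism_flip /=; case: b {rim} => //=; rewrite finset.setUC.
    * case oi: (odd i); last exact: rim.
      rewrite -(edge_set_h fc); apply: rim => //.
      by rewrite /prism_flip /= /up oi odd_ord_pred oi.
    * case oi: (odd i); first exact: rim.
      rewrite -(edge_set_h fc); apply: rim => //.
      by rewrite /prism_flip /= /down oi odd_ord_pred oi.
  + have square (c : 'I_3) (j : 'I_n) : (odd j = (c == c1)) -> c != c0 ->
        prism_face (face_set prism_label c (b, j)).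
      move=> oj c_neq0; apply/or4P/Or44/or4P/Or43/existsP; exists j; apply/eqP.
      by rewrite (prism_square b) oj; move: c_neq0 {oj}; elim/ord3P: c.
    elim/ord3P: (p c2).
    * apply/or4P/Or44/or4P/Or42/existsP; exists b; apply/eqP/setP=> x.
      by rewrite !inE /prism_label /=; case: x.1; case: b {square}.
    * case oi: (odd i); first exact: square.
      rewrite -(face_set_eq (phi_h fc (b, i) (isT : c2 != c1))); apply: square => //.
      by rewrite /prism_flip /= /down oi odd_ord_pred oi.
    * case oi: (odd i); last exact: square.
      rewrite -(face_set_eq (phi_h fc (b, i) (isT : c1 != c2))); apply: square => //.
      by rewrite /prism_flip /= /up oi odd_ord_pred oi.
  + exact: prism_faceT.
Qed.

End Prism.

(** * Projections of the cover onto the prism *)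

Section Projection.
Variable n : nat.
Local Notation Z := 'I_n.+1.
Local Notation N := (4 * n.+1)%N.

(** The position of a pair of parities within a block of four, when the letter with
    parity y leads from position 0 to position 1. *)
Definition gray (y z : bool) : nat :=
  (if z then if y then 2 else 3 else if y then 1 else 0)%N.

Lemma rim_subproof (a : Z) y z : (4 * a + gray y z < N)%N.
Proof. by have := ltn_ord a; case: y; case: z => /=; lia. Qed.

(** The parity of colour 0 chooses the rim, and the position on the cycle with index
    0 is the position on the rim. *)
Definition project (u : cover_vertex n) : bool * 'I_N :=
  let: ((x, y, z), (a, b, c)) := u in (x, Ordinal (rim_subproof a y z)).

Lemma succ_val (a : Z) :
  (a + inZp 1 : Z) = (if a.+1 == n.+1 then 0 else a.+1)%N :> nat.
Proof.
rewrite /= modnDmr addn1; case: eqP => [->|ne]; first by rewrite modnn.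
by rewrite modn_small // ltn_neqAle ltn_ord andbT; apply/eqP.
Qed.

Lemma pred_val (a : Z) :
  (a - inZp 1 : Z) = (if a == 0%N :> nat then n else a.-1) :> nat.
Proof.
have := succ_val (a - inZp 1); rewrite subrK; move: (a - inZp 1) => b.
by have := ltn_ord b; do 2!case: eqP; lia.
Qed.

Lemma N_even : ~~ odd N. Proof. by rewrite oddM. Qed.

Lemma N_gt3 : (3 < N)%N. Proof. by lia. Qed.

Lemma project_flip : coloured_map (@flip n) (@prism_flip N) project 1%g.
Proof.
move=> i [[[x y] z] [[a b] c]]; rewrite perm1; elim/ord3P: i => //.
- rewrite /flip /prism_flip /=; congr pair; apply: val_inj.
  by rewrite [RHS](up_val N_even N_gt3) /=; case: y; case: z => /=; case: ifP; lia.
- rewrite /flip /prism_flip /=; congr pair; apply: val_inj.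
  rewrite [RHS](down_val N_even N_gt3); have := succ_val a; have := pred_val a.
  move: (ltn_ord a); case: y; case: z => /= lta pa sa; rewrite /= ?pa ?sa;
    by do ?case: ifP => ?; lia.
Qed.

Lemma project_surj x : exists u, project u = x.
Proof.
case: x => b i; have ltq : (i %/ 4 < n.+1)%N by have := ltn_ord i; lia.
pose y := (i %% 4 == 1)%N || (i %% 4 == 2)%N; pose z := (1 < i %% 4)%N.
exists ((b, y, z), (Ordinal ltq, 0, 0)); congr pair; apply: val_inj => /=.
rewrite [RHS](divn_eq i 4) mulnC; congr (_ + _)%N; rewrite /y /z.
by have := ltn_pmod i (isT : 0 < 4)%N; case: (i %% 4)%N => [|[|[|[|]]]].
Qed.

Lemma project_inj3 u v : project u = project v ->
  project (turn u) = project (turn v) ->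
  project (turnV u) = project (turnV v) -> u = v.
Proof.
have coord (a a' : Z) y z y' z' :
    (4 * a + gray y z = 4 * a' + gray y' z')%N -> a = a'.
  move=> e; apply: val_inj => /=; move: e.
  by case: y; case: z; case: y'; case: z' => /=; lia.
move: u v => [[[x y] z] [[a b] c]] [[[x' y'] z'] [[a' b'] c']].
move=> /(congr1 (fun p => (p.1, val p.2))) [-> /coord->].
move=> /(congr1 (fun p => (p.1, val p.2))) [-> /coord->].
by move=> /(congr1 (fun p => (p.1, val p.2))) [-> /coord->].
Qed.

Local Notation word_R := (foldr (flag_adj (@flip n))).
Local Notation word_Q := (foldr (flag_adj (@prism_flip N))).

(** From the cover to the prism one surjective equivariant map suffices; conversely
    the three projections [project], [project \o turn] and [project \o turnV]
    together separate the flags of the cover. *)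
Lemma word_equiv w w' :
  (forall t, word_Q t w = word_Q t w') <-> (forall t, word_R t w = word_R t w').
Proof.
have comp A p : coloured_auto (@flip n) A p ->
    coloured_map (@flip n) (@prism_flip N) (project \o A) p.
  by move=> [_ Ah] i u /=; rewrite Ah project_flip perm1.
split=> e t; last first.
  case: t => x p; case: (project_surj x) => u ux.
  have -> : (x, p) = flag_map project 1%g (u, p) by rewrite /flag_map /= ux mulg1.
  by rewrite -!(flag_map_word _ _ project_flip) e.
have proj A p : coloured_auto (@flip n) A p ->
    flag_map (project \o A) p (word_R t w) = flag_map (project \o A) p (word_R t w').
  by move=> /comp Am; rewrite !(flag_map_word _ _ Am) e.
have idaut : coloured_auto (@flip n) id 1%g.
  by split=> [|? ?]; [exact: inv_bij|rewrite perm1].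
have turnaut := turn_auto n; have turnVaut := coloured_auto_comp turnaut turnaut.
have [e1 ep] := proj _ _ idaut.
have [e2 _] := proj _ _ turnaut; have [e3 _] := proj _ _ turnVaut.
rewrite [word_R t w]surjective_pairing [word_R t w']surjective_pairing.
congr pair; last exact: mulIg ep.
by apply: project_inj3 => //; rewrite -!turn3.
Qed.

End Projection.

(** * The minimal regular cover of the prism *)

Lemma adj_involutive (U : finType) (L : eqType) (h : 'I_3 -> U -> U)
    (phi : 'I_3 -> U -> L) (fc : face_colouring h phi) d (X : tbPOrderType d)
    (s : X -> {set U}) (Xs : cell_poset h phi s) i :
  involutive (@adj _ X i).
Proof.
by move=> Psi; have [t ->] := fl_surj fc Xs Psi; rewrite !adj_fl (flag_adjK fc).
Qed.

Lemma cell_poset_isomorphic (U : finType) (L : eqType) (h : 'I_3 -> U -> U)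
    (phi : 'I_3 -> U -> L) d (X : tbPOrderType d) (s : X -> {set U})
    e (Y : tbPOrderType e) :
  cell_poset h phi s -> isomorphic X Y -> exists s', @cell_poset _ _ h phi e Y s'.
Proof.
move=> Xs [f [g fg gf] fm]; exists (s \o g); split=> [x y|x|t k].
- by rewrite -{1}(gf x) -{1}(gf y) fm (cell_le Xs).
- exact: (cell_of Xs).
- by case: (of_cell Xs t k) => x sx; exists (f x); rewrite /= fg.
Qed.

Theorem mainTheorem3 (R : realType) (m : nat) (d : Order.disp_t)
    (P : tbPOrderType d) :
  (1 <= m)%N ->
  minimal_regular_cover P (prism (4 * m)) ->
  [/\ faces_of_rank P 0 #= `I_(8 * m ^ 3),
      faces_of_rank P 1 #= `I_(12 * m ^ 3)
    & faces_of_rank P 2 #= `I_(6 * m ^ 2)] /\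
  [/\ compact [set: surface R P],
      orientable P,
      has_euler_characteristic P ((6 - 4 * m%:Z) * m%:Z ^+ 2)
    & exists2 g : nat,
        g%:Z = (2 * m%:Z - 3) * m%:Z ^+ 2 + 1 & has_genus P g].
Proof.
case: m => [//|n] _ [Preg Pcov Pmin].
have fcQ := prism_colouring (N_even n) (N_gt3 n).
have QsX := prism_cell_poset (N_even n) (N_gt3 n).
have fcR := flip_colouring n.
have RsX := cells_cell_poset (@flip n) (@face_label n) (origin n).
have symm := origin_symmetric n.
have QadjK := adj_involutive fcQ QsX.
have Rreg := cells_regular fcR (@label_connected n) (@flip_connected n) RsX symm.
(* the explicit cover competes with P: it covers the prism and is covered by P *)
have RcovQ : covers (cells (@flip n) (@face_label n)) (prism (4 * n.+1)).
  apply: (cells_cover fcR (@label_connected n) (@flip_connected n) RsX symm QadjK).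
  move=> w w' /word_equiv e Psi; have [t ->] := fl_surj fcQ QsX Psi.
  by rewrite !foldr_adj e.
have PcovR : covers P (cells (@flip n) (@face_label n)).
  apply: (covers_trans_words QadjK) Pcov => w w' e Psi.
  have [t ->] := fl_surj fcR RsX Psi; rewrite !foldr_adj; congr fl.
  move: t; apply/word_equiv => t; apply: (fl_inj (fc := fcQ) (Xs := QsX)).
  by rewrite -!foldr_adj.
have [s Ps] := cell_poset_isomorphic RsX (Pmin _ _ Rreg RcovQ PcovR).
have half := card_half fcR (@flip_parity n); rewrite card_cover_vertex in half.
have V : faces_of_rank P 0 #= `I_(8 * n.+1 ^ 3).
  by rewrite -card_cover_vertex; exact: (card_vertices fcR Ps).
have E : faces_of_rank P 1 #= `I_(12 * n.+1 ^ 3).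
  suff -> : (12 * n.+1 ^ 3 = 3 * #|[set u | ~~ @parity n u]%SET|)%N.
    exact: (card_edges fcR (@flip_parity n) Ps).
  by move: half; set k := (n.+1 ^ 3)%N; set l := #|_|; lia.
have F : faces_of_rank P 2 #= `I_(6 * n.+1 ^ 2).
  suff -> : (6 * n.+1 ^ 2 = 3 * #|{: bool * ('I_n.+1 * 'I_n.+1)}|)%N.
    exact: (card_faces fcR (@label_surj n) Ps).
  by rewrite card_label mulnA.
have orient := cells_orientable fcR (@flip_parity n) Ps.
split=> //; split=> //.
- exact/surface_compact/(finite_flags fcR Ps).
- exists (8 * n.+1 ^ 3)%N, (12 * n.+1 ^ 3)%N, (6 * n.+1 ^ 2)%N; split=> //.
  by rewrite !expnS !expn0 !PoszM expr2; lia.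
- have genus_ge0 (k : nat) : 0 <= (2 * k.+1%:Z - 3) * k.+1%:Z ^+ 2 + 1 :> int.
    case: k => [//|k]; apply: addr_ge0 => //.
    by apply: mulr_ge0; [lia|exact: exprn_ge0].
  exists (absz ((2 * n.+1%:Z - 3) * n.+1%:Z ^+ 2 + 1)); first by rewrite gez0_abs.
  split=> //; exists (8 * n.+1 ^ 3)%N, (12 * n.+1 ^ 3)%N, (6 * n.+1 ^ 2)%N.
  split=> //; rewrite gez0_abs //.
  by rewrite !expnS !expn0 !PoszM expr2; lia.
Qed.
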